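(* The $\mathcal{S}^{*}_{\tau}$-radii for the classes $\mathcal{S}^{*}_{L}, \mathcal{S}^{*}_{C}, \mathcal{S}^{*}_{e}, \Delta^{*}, \mathcal{S}^{*}_{\wp}$ are as follows: (1) $R_{\mathcal{S}^*_{\tau}}(\mathcal{S}^{*}_{L})=\pi(8-\pi)/16$. (2) $R_{\mathcal{S}^*_{\tau}}(\mathcal{S}^{*}_{C})=\sqrt{1+3\pi/8}-1$. (3) $R_{\mathcal{S}^*_{\tau}}(\mathcal{S}^{*}_{e})=\ln(1+\pi/4)$. (4) $R_{\mathcal{S}^*_{\tau}}(\Delta^{*})=\dfrac{\pi(8+\pi)}{8(4+\pi)}$. (5) $R_{\mathcal{S}^*_{\tau}}(\mathcal{S}^{*}_{\wp})$ is the positive root of $re^{r}=\pi/4$, which is approximately $0.484035$. All five radii $R_{\mathcal{S}^*_{\tau}}(\mathcal{S}^{*}_{L})$, $R_{\mathcal{S}^*_{\tau}}(\mathcal{S}^{*}_{C})$, $R_{\mathcal{S}^*_{\tau}}(\mathcal{S}^{*}_{e})$, $R_{\mathcal{S}^*_{\tau}}(\Delta^{*})$ and $R_{\mathcal{S}^*_{\tau}}(\mathcal{S}^{*}_{\wp})$ are sharp.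
   Context: $\mathbb{D}=\{z\in\mathbb{C}:|z|<1\}$. $\mathcal{A}$ is the class of analytic functions $f$ on $\mathbb{D}$ of the form $f(z)=z+\sum_{n\ge 2}a_nz^n$. For analytic $g,h$ on $\mathbb{D}$, $g\prec h$ means $g(z)=h(\omega(z))$ for some analytic $\omega:\mathbb{D}\to\mathbb{D}$ with $\omega(0)=0$, $|\omega(z)|\le|z|$. For a function $\psi$ analytic on $\mathbb{D}$ with $\psi(0)=1$, $\mathcal{S}^{*}(\psi)=\{f\in\mathcal{A}: zf'(z)/f(z)\prec\psi(z)\}$. Then $\mathcal{S}^{*}_{\tau}=\mathcal{S}^{*}(1+\arctan z)$ (principal branch), $\mathcal{S}^{*}_{L}=\mathcal{S}^{*}(\sqrt{1+z})$, $\mathcal{S}^{*}_{C}=\mathcal{S}^{*}(1+4z/3+2z^2/3)$, $\mathcal{S}^{*}_{e}=\mathcal{S}^{*}(e^{z})$, $\Delta^{*}=\mathcal{S}^{*}(z+\sqrt{1+z^2})$, $\mathcal{S}^{*}_{\wp}=\mathcal{S}^{*}(1+ze^{z})$ (principal square roots). For classes $\mathcal{F},\mathcal{G}\subset\mathcal{A}$, the $\mathcal{G}$-radius of $\mathcal{F}$, denoted $R_{\mathcal{G}}(\mathcal{F})$, is the largest $R\in(0,1]$ such that $r^{-1}f(rz)\in\mathcal{G}$ for every $f\in\mathcal{F}$ and every $0<r<R$; ''sharp'' means that the value cannot be increased. *)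

(* Defs.v *)
From Stdlib Require Export Reals.
From Coquelicot Require Export Coquelicot.

Open Scope R_scope.

Definition unit_disc (z : C) : Prop := Cmod z < 1.

(* Functions on the disc are total functions [C -> C] of which only the values
   on the disc matter.  Analytic means holomorphic: complex-differentiable at
   every point of the (open) disc; [ex_derive] is taken over the field [C]. *)
Definition analytic_on_disc (f : C -> C) : Prop :=
  forall z : C, unit_disc z -> ex_derive (K := C_AbsRing) (V := C_NormedModule) f z.

Definition class_A (f : C -> C) : Prop :=
  analytic_on_disc f /\
  exists a : nat -> C,
    a 0%nat = RtoC 0 /\ a 1%nat = RtoC 1 /\
    forall z : C, unit_disc z ->
      is_pseries (K := C_AbsRing) (V := C_NormedModule) a z (f z).

Definition subordinate (g h : C -> C) : Prop :=
  analytic_on_disc g /\ analytic_on_disc h /\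
  exists w : C -> C,
    analytic_on_disc w /\
    (forall z : C, unit_disc z -> unit_disc (w z)) /\
    w (RtoC 0) = RtoC 0 /\
    (forall z : C, unit_disc z -> Cmod (w z) <= Cmod z) /\
    forall z : C, unit_disc z -> g z = h (w z).

(* z f'(z) / f(z), with its removable singularity at 0 filled in by the limit 1
   (for f in [class_A]). *)
Definition zdlog (f : C -> C) (z : C) : C :=
  if Ceq_dec z (RtoC 0) then RtoC 1 else (z * C_derive f z / f z)%C.

(* Division is total on [C], so the requirement that z f'/f be defined on the
   disc is spelled out: f has no zero there other than 0. *)
Definition class_S (psi : C -> C) (f : C -> C) : Prop :=
  class_A f /\
  (forall z : C, unit_disc z -> z <> RtoC 0 -> f z <> RtoC 0) /\
  subordinate (zdlog f) psi.

Definition Cexp (z : C) : C :=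
  (exp (Re z) * cos (Im z), exp (Re z) * sin (Im z)).

(* Principal argument, with values in (-PI, PI]; meaningful for z <> 0. *)
Definition Carg (z : C) : R :=
  if Rle_dec 0 (Im z) then acos (Re z / Cmod z) else - acos (Re z / Cmod z).

Definition Clog (z : C) : C := (ln (Cmod z), Carg z).

Definition Csqrt (z : C) : C :=
  if Ceq_dec z (RtoC 0) then RtoC 0 else Cexp (Clog z / 2)%C.

Definition Catan (z : C) : C :=
  ((Clog (1 + Ci * z) - Clog (1 - Ci * z)) / (2 * Ci))%C.

Definition S_tau : (C -> C) -> Prop := class_S (fun z => 1 + Catan z)%C.
Definition S_L : (C -> C) -> Prop := class_S (fun z => Csqrt (1 + z))%C.
Definition S_C : (C -> C) -> Prop :=
  class_S (fun z => 1 + 4 * z / 3 + 2 * z ^ 2 / 3)%C.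
Definition S_e : (C -> C) -> Prop := class_S Cexp.
Definition Delta_star : (C -> C) -> Prop :=
  class_S (fun z => z + Csqrt (1 + z ^ 2))%C.
Definition S_wp : (C -> C) -> Prop := class_S (fun z => 1 + z * Cexp z)%C.

Definition dilation (r : R) (f : C -> C) (z : C) : C := (/ r * f (r * z))%C.

Definition dilations_in (G F : (C -> C) -> Prop) (R0 : R) : Prop :=
  forall f : C -> C, F f -> forall r : R, 0 < r < R0 -> G (dilation r f).

(* [is_radius G F R0]: R0 is the G-radius of F, i.e. the largest element of
   (0, 1] satisfying [dilations_in G F]. *)
Definition is_radius (G F : (C -> C) -> Prop) (R0 : R) : Prop :=
  (0 < R0 <= 1 /\ dilations_in G F R0) /\
  forall R1 : R, 0 < R1 <= 1 -> dilations_in G F R1 -> R1 <= R0.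

(* Already a consequence of the maximality in [is_radius]. *)
Definition sharp (G F : (C -> C) -> Prop) (R0 : R) : Prop :=
  forall R1 : R, R0 < R1 <= 1 ->
    exists f : C -> C, F f /\ exists r : R, 0 < r < R1 /\ ~ G (dilation r f).

(* Main.v *)
Require Import Defs.
From Stdlib Require Import Reals Lra Lia Psatz Arith Factorial.
From Stdlib Require Import Classical ClassicalEpsilon Machin.
From Coquelicot Require Import Coquelicot.
Open Scope R_scope.

(** Since tan maps the strip |Re W| < PI / 4 conformally onto the unit disc, with inverse
    arctan, the function 1 + arctan maps the disc onto the strip |Re w - 1| < PI / 4.
    A function f thus belongs to S*_tau only if z f'/f takes its values in that strip
    ([S_tau_strip]).  Each of the five radii is the largest R0 such that psi maps
    |u| < R0 into the strip, as expressed by [tau_radius].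

    If psi does so and z f'/f = psi(w(z)), then tan (psi - 1) is bounded by 1 on
    |u| < R0 and vanishes at 0, so Schwarz's lemma gives |tan (psi(u) - 1)| <= |u| / R0.
    For r < R0 the function tan (psi(w(rz)) - 1) is therefore bounded by |z|, and it
    subordinates the dilation of f to 1 + arctan ([dilations_in_S_tau]).  Conversely,
    the extremal function f = z u with u' = ((psi - 1)/z) u satisfies z f'/f = psi; as
    soon as r exceeds R0, its dilation takes at u0 / r the value psi(u0), outside the strip.

    The complex analysis is elementary and uses no integrals.  The maximum principle
    behind [schwarz] rests on second-order expansions: at an interior maximum of
    |h|^2 + e|z|^2, averaging over the four points z0 + i^k s gives a larger value.
    The extremal function is built from its coefficients: if those of (psi - 1)/z are at
    most 2 in modulus, those of u are at most n + 1 ([ode_coef_bound]), which gives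
    convergence on the disc, and u has no zero because its product with the solution
    for the opposite equation is constant.  The power series of the five functions psi
    are identified by the linear differential equations that they satisfy
    ([linear_ode_unique]).

    What remains is real: where Re psi reaches 1 - PI/4 or 1 + PI/4 on circles, and the
    numerical bracket for the root of r e^r = PI / 4. *)

(** * Complex differentiation *)

Lemma RtoC_neq_0 (x : R) : x <> 0 -> RtoC x <> 0.
Proof. intros H E; apply H, RtoC_inj; exact E. Qed.

(** [f] is complex-differentiable at [z] with derivative [l], in epsilon-delta form
    with increments measured by [Cmod]. *)
Definition Cderiv (f : C -> C) (z l : C) : Prop :=
  forall eps : R, 0 < eps -> exists d : R, 0 < d /\
    forall h : C, Cmod h < d ->
      Cmod (f (z + h) - f z - l * h)%C <= eps * Cmod h.

Lemma Cderiv_is_derive (f : C -> C) (z l : C) :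
  Cderiv f z l <->
  is_derive (K := C_AbsRing) (V := C_NormedModule) f z l.
Proof.
split.
- intros H; split.
  + apply is_linear_scal_l.
  + intros x Hx eps.
    assert (Hxz : z = x) by (apply (is_filter_lim_locally_unique (V:=AbsRing_NormedModule C_AbsRing) z x Hx)).
    subst x.
    destruct (H eps (cond_pos eps)) as [d [Hd Hf]].
    exists (mkposreal d Hd); intros y Hy.
    assert (E : forall y : C, y = (z + (y - z))%C) by (intros; ring).
    specialize (Hf (y - z)%C Hy).
    rewrite <- E in Hf; clear E.
    change (Cmod (f y - f z - (y - z) * l)%C <= eps * Cmod (y - z)%C).
    replace (f y - f z - (y - z) * l)%C with (f y - f z - l * (y - z))%C by ring.
    exact Hf.
- intros [_ H] eps He.
  destruct (H z (fun P HP => HP) (mkposreal eps He)) as [d Hd].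
  exists d; split; [apply cond_pos|].
  intros h Hh.
  assert (Hb : ball (M := AbsRing_UniformSpace C_AbsRing) z d (z + h)%C).
  { change (Cmod (z + h - z)%C < d). replace (z + h - z)%C with h by ring. exact Hh. }
  specialize (Hd _ Hb).
  change (Cmod (f (z + h) - f z - (z + h - z) * l)%C <= eps * Cmod (z + h - z)%C) in Hd.
  replace (z + h - z)%C with h in Hd by ring.
  replace (f (z + h) - f z - l * h)%C with (f (z + h) - f z - h * l)%C by ring.
  exact Hd.
Qed.

Lemma Cderiv_ext_loc (f g : C -> C) (z l : C) (r : R) :
  0 < r -> (forall h, Cmod h < r -> f (z + h)%C = g (z + h)%C) ->
  Cderiv f z l -> Cderiv g z l.
Proof.
intros Hr Hfg H eps He.
destruct (H eps He) as [d [Hd Hf]].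
exists (Rmin d r); split; [apply Rmin_pos; assumption|].
intros h Hh.
assert (E0 : f z = g z).
{ specialize (Hfg 0). rewrite Cmod_0 in Hfg.
  replace (z + 0)%C with z in Hfg by ring. apply Hfg; exact Hr. }
rewrite <- E0, <- Hfg.
- apply Hf. apply Rlt_le_trans with (1 := Hh); apply Rmin_l.
- apply Rlt_le_trans with (1 := Hh); apply Rmin_r.
Qed.

Lemma Cderiv_ext (f g : C -> C) (z l : C) :
  (forall x, f x = g x) -> Cderiv f z l -> Cderiv g z l.
Proof.
intros Hfg; apply Cderiv_ext_loc with 1; [lra|]; auto.
Qed.

Lemma Cderiv_const (c z : C) : Cderiv (fun _ => c) z 0.
Proof.
intros eps He; exists 1; split; [lra|]; intros h _.
replace (c - c - 0 * h)%C with (RtoC 0) by ring.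
rewrite Cmod_0. apply Rmult_le_pos; [lra|apply Cmod_ge_0].
Qed.

Lemma Cderiv_id (z : C) : Cderiv (fun x => x) z 1.
Proof.
intros eps He; exists 1; split; [lra|]; intros h _.
replace (z + h - z - 1 * h)%C with (RtoC 0) by ring.
rewrite Cmod_0. apply Rmult_le_pos; [lra|apply Cmod_ge_0].
Qed.

Lemma Cderiv_plus (f g : C -> C) (z a b : C) :
  Cderiv f z a -> Cderiv g z b -> Cderiv (fun x => f x + g x)%C z (a + b).
Proof.
intros Hf Hg eps He.
destruct (Hf (eps/2)) as [d1 [Hd1 H1]]; [lra|].
destruct (Hg (eps/2)) as [d2 [Hd2 H2]]; [lra|].
exists (Rmin d1 d2); split; [apply Rmin_pos; assumption|].
intros h Hh.
replace (f (z + h) + g (z + h) - (f z + g z) - (a + b) * h)%C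
  with ((f (z + h) - f z - a * h) + (g (z + h) - g z - b * h))%C by ring.
eapply Rle_trans; [apply Cmod_triangle|].
assert (Cmod h < d1) by (apply Rlt_le_trans with (1 := Hh); apply Rmin_l).
assert (Cmod h < d2) by (apply Rlt_le_trans with (1 := Hh); apply Rmin_r).
specialize (H1 h H); specialize (H2 h H0). lra.
Qed.

(** Increments are dominated linearly near a point of differentiability. *)
Lemma Cderiv_lipschitz (f : C -> C) (z l : C) :
  Cderiv f z l -> exists d, 0 < d /\
    forall h, Cmod h < d -> Cmod (f (z + h) - f z)%C <= (Cmod l + 1) * Cmod h.
Proof.
intros H. destruct (H 1) as [d [Hd Hf]]; [lra|].
exists d; split; [exact Hd|]; intros h Hh.
replace (f (z + h) - f z)%C with ((f (z + h) - f z - l * h) + l * h)%C by ring.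
eapply Rle_trans; [apply Cmod_triangle|].
rewrite Cmod_mult. specialize (Hf h Hh). lra.
Qed.

(** Continuity of [f] at [z]. *)
Definition Ccont (f : C -> C) (z : C) : Prop :=
  forall eps : R, 0 < eps -> exists d : R, 0 < d /\
    forall h : C, Cmod h < d -> Cmod (f (z + h) - f z)%C < eps.

Lemma Cderiv_cont (f : C -> C) (z l : C) : Cderiv f z l -> Ccont f z.
Proof.
intros H eps He.
destruct (Cderiv_lipschitz f z l H) as [d [Hd Hf]].
assert (0 < Cmod l + 1) by (pose proof (Cmod_ge_0 l); lra).
exists (Rmin d (eps / (Cmod l + 1))); split.
- apply Rmin_pos; [exact Hd|apply Rdiv_lt_0_compat; lra].
- intros h Hh. eapply Rle_lt_trans.
  + apply Hf. apply Rlt_le_trans with (1 := Hh); apply Rmin_l.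
  + assert (Cmod h < eps / (Cmod l + 1)) by (apply Rlt_le_trans with (1 := Hh); apply Rmin_r).
    apply Rlt_le_trans with ((Cmod l + 1) * (eps / (Cmod l + 1))).
    * apply Rmult_lt_compat_l; assumption.
    * right; field; lra.
Qed.

Lemma Cderiv_comp (f g : C -> C) (z a b : C) :
  Cderiv f (g z) a -> Cderiv g z b -> Cderiv (fun x => f (g x)) z (a * b)%C.
Proof.
intros Hf Hg eps He.
destruct (Cderiv_lipschitz g z b Hg) as [d0 [Hd0 L]].
set (M := Cmod b + 1) in *.
assert (HM : 0 < M) by (unfold M; pose proof (Cmod_ge_0 b); lra).
assert (HA : 0 <= Cmod a) by apply Cmod_ge_0.
destruct (Hf (eps / (2 * M))) as [d1 [Hd1 H1]]; [apply Rdiv_lt_0_compat; lra|].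
destruct (Hg (eps / (2 * (Cmod a + 1)))) as [d2 [Hd2 H2]]; [apply Rdiv_lt_0_compat; lra|].
exists (Rmin (Rmin d0 d2) (d1 / M)); split.
{ apply Rmin_pos; [apply Rmin_pos; assumption|apply Rdiv_lt_0_compat; assumption]. }
intros h Hh.
assert (h0 : Cmod h < d0).
{ apply Rlt_le_trans with (1 := Hh). eapply Rle_trans; [apply Rmin_l|apply Rmin_l]. }
assert (h2 : Cmod h < d2).
{ apply Rlt_le_trans with (1 := Hh). eapply Rle_trans; [apply Rmin_l|apply Rmin_r]. }
assert (h1 : Cmod h < d1 / M).
{ apply Rlt_le_trans with (1 := Hh); apply Rmin_r. }
set (k := (g (z + h) - g z)%C).
assert (Hk : Cmod k <= M * Cmod h) by (apply L; exact h0).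
assert (Hk1 : Cmod k < d1).
{ eapply Rle_lt_trans; [exact Hk|].
  apply Rlt_le_trans with (M * (d1 / M)).
  - apply Rmult_lt_compat_l; assumption.
  - right; field; lra. }
assert (E : g (z + h)%C = (g z + k)%C) by (unfold k; ring).
specialize (H1 k Hk1). specialize (H2 h h2). fold k in H2.
replace (f (g (z + h)) - f (g z) - a * b * h)%C
  with ((f (g z + k) - f (g z) - a * k) + a * (k - b * h))%C by (rewrite <- E; ring).
eapply Rle_trans; [apply Cmod_triangle|].
rewrite Cmod_mult.
assert (A1 : eps / (2 * M) * Cmod k <= eps / 2 * Cmod h).
{ apply Rle_trans with (eps / (2 * M) * (M * Cmod h)).
  - apply Rmult_le_compat_l; [|exact Hk]. left; apply Rdiv_lt_0_compat; lra.
  - right; field; lra. }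
assert (A2 : Cmod a * Cmod (k - b * h)%C <= eps / 2 * Cmod h).
{ apply Rle_trans with ((Cmod a + 1) * (eps / (2 * (Cmod a + 1)) * Cmod h)).
  - apply Rmult_le_compat; [lra|apply Cmod_ge_0|lra|exact H2].
  - right; field; lra. }
lra.
Qed.

Lemma Cderiv_scal (c : C) (f : C -> C) (z a : C) :
  Cderiv f z a -> Cderiv (fun x => c * f x)%C z (c * a)%C.
Proof.
intros H.
apply (Cderiv_comp (fun x => c * x)%C f z c a); [|exact H].
intros eps He; exists 1; split; [lra|]; intros h _.
replace (c * (f z + h) - c * f z - c * h)%C with (RtoC 0) by ring.
rewrite Cmod_0. apply Rmult_le_pos; [lra|apply Cmod_ge_0].
Qed.

Lemma Cderiv_sqr (z : C) : Cderiv (fun x => x * x)%C z (2 * z)%C.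
Proof.
intros eps He; exists eps; split; [exact He|]; intros h Hh.
replace ((z + h) * (z + h) - z * z - 2 * z * h)%C with (h * h)%C by ring.
rewrite Cmod_mult. apply Rmult_le_compat_r; [apply Cmod_ge_0|lra].
Qed.

Lemma Cderiv_opp (f : C -> C) (z a : C) :
  Cderiv f z a -> Cderiv (fun x => - f x)%C z (- a)%C.
Proof.
intros H. apply (Cderiv_scal (-(1))%C) in H.
replace (- a)%C with (- (1) * a)%C by ring.
revert H; apply Cderiv_ext; intros; ring.
Qed.

Lemma Cderiv_minus (f g : C -> C) (z a b : C) :
  Cderiv f z a -> Cderiv g z b -> Cderiv (fun x => f x - g x)%C z (a - b)%C.
Proof.
intros Hf Hg. apply Cderiv_plus; [exact Hf|]. apply Cderiv_opp; exact Hg.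
Qed.

(** Product rule, by polarisation: 4 f g = (f+g)^2 - (f-g)^2. *)
Lemma Cderiv_mult (f g : C -> C) (z a b : C) :
  Cderiv f z a -> Cderiv g z b ->
  Cderiv (fun x => f x * g x)%C z (a * g z + f z * b)%C.
Proof.
intros Hf Hg.
assert (H1 := Cderiv_comp (fun x => x * x)%C _ z _ _ (Cderiv_sqr _) (Cderiv_plus f g z a b Hf Hg)).
assert (H2 := Cderiv_comp (fun x => x * x)%C _ z _ _ (Cderiv_sqr _) (Cderiv_minus f g z a b Hf Hg)).
assert (H := Cderiv_scal (/ 4)%C _ _ _ (Cderiv_minus _ _ _ _ _ H1 H2)).
assert (N : RtoC 4 <> 0) by (apply RtoC_neq_0; lra).
replace (a * g z + f z * b)%C
  with (/ 4 * (2 * (f z + g z) * (a + b) - 2 * (f z - g z) * (a - b)))%C by (field; exact N).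
revert H; apply Cderiv_ext; intros; field; exact N.
Qed.

Lemma Cderiv_inv_at (z : C) : z <> 0 -> Cderiv (fun x => / x)%C z (- / (z * z))%C.
Proof.
intros Hz eps He.
assert (Hm : 0 < Cmod z) by (apply Cmod_gt_0; exact Hz).
set (m := Cmod z) in *.
exists (Rmin (m / 2) (eps * (m * m * m) / 2)); split.
{ apply Rmin_pos; [lra|]. assert (0 < m * m * m) by (repeat apply Rmult_lt_0_compat; lra).
  assert (0 < eps * (m * m * m)) by (apply Rmult_lt_0_compat; lra). lra. }
intros h Hh.
assert (h1 : Cmod h < m / 2) by (apply Rlt_le_trans with (1 := Hh); apply Rmin_l).
assert (h2 : Cmod h < eps * (m * m * m) / 2) by (apply Rlt_le_trans with (1 := Hh); apply Rmin_r).
assert (B : m / 2 <= Cmod (z + h)%C).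
{ assert (m <= Cmod (z + h)%C + Cmod h).
  { unfold m. replace z with ((z + h) + - h)%C at 1 by ring.
    rewrite <- (Cmod_opp h). apply Cmod_triangle. }
  lra. }
assert (Hzh : (z + h)%C <> 0) by (apply Cmod_gt_0; lra).
replace (/ (z + h) - / z - - / (z * z) * h)%C with (h * h / (z * z * (z + h)))%C
  by (field; split; assumption).
rewrite Cmod_div, !Cmod_mult.
2:{ apply Cmod_gt_0. rewrite !Cmod_mult. fold m. repeat apply Rmult_lt_0_compat; lra. }
fold m.
assert (P : 0 < m * m * m) by (repeat apply Rmult_lt_0_compat; lra).
assert (P2 : 0 < m * m * Cmod (z + h)%C) by (repeat apply Rmult_lt_0_compat; lra).
apply Rle_div_l; [exact P2|].
assert (0 <= Cmod h) by apply Cmod_ge_0.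
apply Rle_trans with (eps * (m * m * m) / 2 * Cmod h).
- apply Rmult_le_compat_r; lra.
- assert (m * m * (m/2) <= m * m * Cmod (z + h)%C) by (apply Rmult_le_compat_l; [nra|exact B]).
  assert (0 <= eps * Cmod h) by (apply Rmult_le_pos; lra).
  nra.
Qed.

Lemma Cderiv_inv (f : C -> C) (z a : C) :
  f z <> 0 -> Cderiv f z a -> Cderiv (fun x => / f x)%C z (- a / (f z * f z))%C.
Proof.
intros N H.
replace (- a / (f z * f z))%C with (- / (f z * f z) * a)%C by (field; exact N).
apply (Cderiv_comp Cinv f); [|exact H]. apply Cderiv_inv_at; exact N.
Qed.

Lemma Cderiv_div (f g : C -> C) (z a b : C) :
  g z <> 0 -> Cderiv f z a -> Cderiv g z b ->
  Cderiv (fun x => f x / g x)%C z ((a * g z - f z * b) / (g z * g z))%C.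
Proof.
intros N Hf Hg.
replace ((a * g z - f z * b) / (g z * g z))%C
  with (a * / g z + f z * (- b / (g z * g z)))%C by (field; exact N).
apply (Cderiv_mult f (fun x => / g x)%C); [exact Hf|]. apply Cderiv_inv; assumption.
Qed.

Lemma Cderiv_unique_C_derive (f : C -> C) (z l : C) : Cderiv f z l -> C_derive f z = l.
Proof.
intros H. apply is_C_derive_unique. apply Cderiv_is_derive. exact H.
Qed.

Lemma ex_derive_Cderiv (f : C -> C) (z : C) :
  ex_derive (K := C_AbsRing) (V := C_NormedModule) f z <-> exists l, Cderiv f z l.
Proof.
split; intros [l H]; exists l; apply Cderiv_is_derive; exact H.
Qed.

(** The mean value inequality along the segment from [z] to [z + h]: the real mean
    value theorem applied to s |-> Re (conj c f(z + s h)) with c = f(z + h) - f z. *)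
Lemma mean_value_ineq (f df : C -> C) (z h : C) (M : R) :
  (forall s, 0 <= s <= 1 -> Cderiv f (z + s * h)%C (df (z + s * h)%C)) ->
  (forall s, 0 <= s <= 1 -> Cmod (df (z + s * h)%C) <= M) ->
  Cmod (f (z + h) - f z)%C <= M * Cmod h.
Proof.
intros Hd HM.
set (c := (f (z + h) - f z)%C).
set (phi := fun s : R => Re (Cconj c * f (z + s * h))%C).
set (dphi := fun s : R => Re (Cconj c * (df (z + s * h) * h))%C).
assert (D : forall s, 0 <= s <= 1 -> derivable_pt_lim phi s (dphi s)).
{ intros s Hs eps He.
  assert (K : 0 < Cmod c * (Cmod h + 1) + 1).
  { pose proof (Cmod_ge_0 c). pose proof (Cmod_ge_0 h). nra. }
  destruct (Hd s Hs (eps / (Cmod c * (Cmod h + 1) + 1))) as [d [Hd0 H0]].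
  { apply Rdiv_lt_0_compat; lra. }
  assert (K2 : 0 < Cmod h + 1) by (pose proof (Cmod_ge_0 h); lra).
  assert (K3 : 0 < d / (Cmod h + 1)) by (apply Rdiv_lt_0_compat; lra).
  exists (mkposreal _ K3). intros t Ht Htd. simpl in Htd.
  assert (Hth : Cmod (t * h)%C < d).
  { rewrite Cmod_mult, Cmod_R.
    apply Rle_lt_trans with (Rabs t * (Cmod h + 1)).
    - apply Rmult_le_compat_l; [apply Rabs_pos|lra].
    - apply Rlt_div_r in Htd; [lra|exact K2]. }
  specialize (H0 _ Hth).
  replace (z + s * h + t * h)%C with (z + (s + t)%R * h)%C in H0 by (rewrite RtoC_plus; ring).
  set (r := (f (z + (s + t)%R * h) - f (z + s * h) - df (z + s * h) * (t * h))%C) in *.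
  assert (E : (phi (s + t) - phi s) / t - dphi s = Re (Cconj c * r)%C / t).
  { unfold phi, dphi, r.
    set (u := f (z + (s + t)%R * h)%C). set (v := f (z + s * h)%C). set (w := df (z + s * h)%C).
    destruct u, v, w, h, c. simpl. unfold Re, Im; simpl. field. exact Ht. }
  rewrite E. unfold Rdiv at 1. rewrite Rabs_mult.
  assert (B : Rabs (Re (Cconj c * r)%C) <= Cmod c * (eps / (Cmod c * (Cmod h + 1) + 1) * (Rabs t * Cmod h))).
  { eapply Rle_trans; [apply re_le_Cmod|]. rewrite Cmod_mult, Cmod_conj.
    apply Rmult_le_compat_l; [apply Cmod_ge_0|].
    rewrite Cmod_mult, Cmod_R in H0. exact H0. }
  assert (Pt : 0 < Rabs t) by (apply Rabs_pos_lt; exact Ht).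
  rewrite Rabs_inv.
  apply Rle_lt_trans with (Cmod c * (eps / (Cmod c * (Cmod h + 1) + 1) * (Rabs t * Cmod h)) * / Rabs t).
  { apply Rmult_le_compat_r; [left; apply Rinv_0_lt_compat; exact Pt|exact B]. }
  replace (Cmod c * (eps / (Cmod c * (Cmod h + 1) + 1) * (Rabs t * Cmod h)) * / Rabs t)
    with (eps * ((Cmod c * Cmod h) / (Cmod c * (Cmod h + 1) + 1))) by (field; lra).
  rewrite <- (Rmult_1_r eps) at 2.
  apply Rmult_lt_compat_l; [exact He|].
  apply Rlt_div_l; [exact K|]. pose proof (Cmod_ge_0 c). lra. }
assert (HMVT : exists s, phi 1 - phi 0 = dphi s * (1 - 0) /\ 0 < s < 1).
{ apply (MVT_cor2 phi dphi 0 1); [lra|exact D]. }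
destruct HMVT as [s [Es Hs]].
assert (Ec : phi 1 - phi 0 = Cmod c ^ 2).
{ rewrite Cmod2_alt. unfold phi.
  replace (z + 1 * h)%C with (z + h)%C by ring.
  replace (z + 0 * h)%C with z by ring.
  unfold c. destruct (f (z + h)%C), (f z). simpl. unfold Re, Im; simpl. ring. }
assert (B : dphi s <= Cmod c * (M * Cmod h)).
{ unfold dphi. eapply Rle_trans; [apply Rle_abs|]. eapply Rle_trans; [apply re_le_Cmod|].
  rewrite !Cmod_mult, Cmod_conj.
  apply Rmult_le_compat_l; [apply Cmod_ge_0|].
  apply Rmult_le_compat_r; [apply Cmod_ge_0|]. apply HM; lra. }
assert (0 <= Cmod c) by apply Cmod_ge_0.
destruct (Req_dec (Cmod c) 0) as [Z|NZ].
- rewrite Z. apply Rmult_le_pos; [|apply Cmod_ge_0].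
  eapply Rle_trans; [apply Cmod_ge_0|apply (HM 0)]; lra.
- apply Rmult_le_reg_l with (Cmod c); nra.
Qed.

Lemma Cmod_scal_le (s : R) (z : C) : 0 <= s <= 1 -> Cmod (s * z)%C <= Cmod z.
Proof.
intros Hs. rewrite Cmod_mult, Cmod_R, Rabs_pos_eq by lra.
rewrite <- (Rmult_1_l (Cmod z)) at 2. apply Rmult_le_compat_r; [apply Cmod_ge_0|lra].
Qed.

Lemma zero_derivative_const (f : C -> C) (z : C) :
  (forall x, unit_disc x -> Cderiv f x 0) -> unit_disc z -> f z = f 0.
Proof.
intros H Hz.
assert (B : Cmod (f (0 + z) - f 0)%C <= 0 * Cmod z).
{ apply (mean_value_ineq f (fun _ => RtoC 0)).
  - intros s Hs. apply H. unfold unit_disc.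
    rewrite Cplus_0_l. eapply Rle_lt_trans; [apply Cmod_scal_le; exact Hs|exact Hz].
  - intros; rewrite Cmod_0; lra. }
rewrite Cplus_0_l, Rmult_0_l in B.
assert (E : (f z - f 0)%C = 0).
{ apply Cmod_eq_0. pose proof (Cmod_ge_0 (f z - f 0)%C). lra. }
replace (f z) with ((f z - f 0) + f 0)%C by ring. rewrite E; ring.
Qed.

(** Two solutions of y' = q y on the disc with the same value at 0 agree,
    provided one of them has no zero: their quotient has derivative 0. *)
Lemma linear_ode_unique (q f g : C -> C) (z : C) :
  (forall x, unit_disc x -> Cderiv f x (q x * f x)%C) ->
  (forall x, unit_disc x -> Cderiv g x (q x * g x)%C) ->
  (forall x, unit_disc x -> g x <> 0) ->
  f 0 = g 0 -> unit_disc z -> f z = g z.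
Proof.
intros Hf Hg N E Hz.
assert (K : (f z / g z)%C = (f 0 / g 0)%C).
{ apply (zero_derivative_const (fun x => f x / g x)%C); [|exact Hz].
  intros x Hx.
  replace (RtoC 0) with ((q x * f x * g x - f x * (q x * g x)) / (g x * g x))%C
    by (field; apply N; exact Hx).
  apply Cderiv_div; auto. }
assert (U0 : unit_disc 0) by (unfold unit_disc; rewrite Cmod_0; lra).
rewrite E in K.
replace (f z) with (f z / g z * g z)%C by (field; apply N; exact Hz).
rewrite K. field. apply N; exact U0.
Qed.

(** * Complex power series *)

(** The series of the [a n] converges to [l] in C. *)
Definition Cseries (a : nat -> C) (l : C) : Prop :=
  is_series (K := C_AbsRing) (V := C_NormedModule) a l.

Lemma sum_n_Re (a : nat -> C) (n : nat) :
  Re (sum_n (G := C_AbelianMonoid) a n) = sum_n (fun k => Re (a k)) n.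
Proof.
induction n as [|n IH].
- now rewrite !sum_O.
- rewrite !sum_Sn, <- IH. reflexivity.
Qed.

Lemma sum_n_Im (a : nat -> C) (n : nat) :
  Im (sum_n (G := C_AbelianMonoid) a n) = sum_n (fun k => Im (a k)) n.
Proof.
induction n as [|n IH].
- now rewrite !sum_O.
- rewrite !sum_Sn, <- IH. reflexivity.
Qed.

Lemma Cseries_components (a : nat -> C) (l : C) :
  Cseries a l <->
  is_series (fun n => Re (a n)) (Re l) /\ is_series (fun n => Im (a n)) (Im l).
Proof.
unfold Cseries, is_series. split.
- intros H. split.
  + apply filterlim_ext with (fun n => fst (sum_n (G := C_AbelianMonoid) a n)).
    { intros n. apply (sum_n_Re a n). }
    apply filterlim_locally. intros eps.
    apply (proj1 (filterlim_locally (F := eventually) (U := C_UniformSpace) _ l)) with (eps := eps) in H.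
    revert H. apply filter_imp. intros n [H _]. exact H.
  + apply filterlim_ext with (fun n => snd (sum_n (G := C_AbelianMonoid) a n)).
    { intros n. apply (sum_n_Im a n). }
    apply filterlim_locally. intros eps.
    apply (proj1 (filterlim_locally (F := eventually) (U := C_UniformSpace) _ l)) with (eps := eps) in H.
    revert H. apply filter_imp. intros n [_ H]. exact H.
- intros [H1 H2].
  apply (proj2 (filterlim_locally (F := eventually) (U := C_UniformSpace) _ l)). intros eps.
  generalize (filter_and _ _
    (proj1 (filterlim_locally (F := eventually) (U := R_UniformSpace) _ (Re l)) H1 eps)
    (proj1 (filterlim_locally (F := eventually) (U := R_UniformSpace) _ (Im l)) H2 eps)).
  apply filter_imp. intros n [K1 K2].
  rewrite <- sum_n_Re in K1. rewrite <- sum_n_Im in K2.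
  split; assumption.
Qed.

Lemma Cseries_unique (a : nat -> C) (l m : C) : Cseries a l -> Cseries a m -> l = m.
Proof.
rewrite !Cseries_components. intros [H1 H2] [H3 H4].
apply is_series_unique in H1; apply is_series_unique in H2.
apply is_series_unique in H3; apply is_series_unique in H4.
destruct l, m. unfold Re, Im in *. simpl in *. congruence.
Qed.

Lemma Cseries_ext (a b : nat -> C) (l : C) :
  (forall n, a n = b n) -> Cseries a l -> Cseries b l.
Proof. intros H. apply (is_series_ext (V := C_NormedModule)). exact H. Qed.

Lemma Cseries_scal (c : C) (a : nat -> C) (l : C) :
  Cseries a l -> Cseries (fun n => c * a n)%C (c * l)%C.
Proof. apply (is_series_scal (K := C_AbsRing) (V := C_NormedModule)). Qed.

Lemma Cseries_minus (a b : nat -> C) (l m : C) :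
  Cseries a l -> Cseries b m -> Cseries (fun n => a n - b n)%C (l - m)%C.
Proof. apply (is_series_minus (V := C_NormedModule)). Qed.

Lemma Cseries_incr_1 (a : nat -> C) (l : C) :
  Cseries (fun k => a (S k)) (l - a 0%nat)%C <-> Cseries a l.
Proof.
split; intros H.
- apply (is_series_decr_1 (V := C_NormedModule)). exact H.
- apply (is_series_incr_1 (V := C_NormedModule)).
  change (Cseries a ((l - a 0%nat) + a 0%nat)%C).
  replace ((l - a 0%nat) + a 0%nat)%C with l by ring. exact H.
Qed.

Lemma im_le_Cmod (c : C) : Rabs (Im c) <= Cmod c.
Proof.
eapply Rle_trans; [|apply Rmax_Cmod]. apply Rmax_r.
Qed.

(** Sum of a complex series, meaningful when the series converges. *)
Definition CSum (a : nat -> C) : C :=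
  (Series (fun n => Re (a n)), Series (fun n => Im (a n))).

Lemma ex_abs_Re (a : nat -> C) :
  ex_series (fun n => Cmod (a n)) -> ex_series (fun n => Rabs (Re (a n))).
Proof.
apply (ex_series_le (K := R_AbsRing) (V := R_CompleteNormedModule) (fun n => Rabs (Re (a n)))).
intros n. change (Rabs (Rabs (Re (a n))) <= Cmod (a n)). rewrite Rabs_Rabsolu. apply re_le_Cmod.
Qed.

Lemma ex_abs_Im (a : nat -> C) :
  ex_series (fun n => Cmod (a n)) -> ex_series (fun n => Rabs (Im (a n))).
Proof.
apply (ex_series_le (K := R_AbsRing) (V := R_CompleteNormedModule) (fun n => Rabs (Im (a n)))).
intros n. change (Rabs (Rabs (Im (a n))) <= Cmod (a n)). rewrite Rabs_Rabsolu. apply im_le_Cmod.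
Qed.

Lemma CSum_correct (a : nat -> C) :
  ex_series (fun n => Cmod (a n)) -> Cseries a (CSum a).
Proof.
intros H. apply Cseries_components. unfold CSum. split.
- apply (Series_correct (fun n => Re (a n))). apply ex_series_Rabs, ex_abs_Re, H.
- apply (Series_correct (fun n => Im (a n))). apply ex_series_Rabs, ex_abs_Im, H.
Qed.

Lemma is_series_nonneg (b : nat -> R) (m : R) :
  is_series b m -> (forall n, 0 <= b n) -> 0 <= m.
Proof.
intros Hb H.
apply (is_lim_seq_le (fun _ => 0) (sum_n b) (Finite 0) (Finite m)); [|apply is_lim_seq_const|exact Hb].
induction n as [|n IH]; [rewrite sum_O; apply H|].
rewrite sum_Sn. apply Rplus_le_le_0_compat; [exact IH|apply H].
Qed.

(** The triangle inequality for series. *)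
Lemma Cseries_bound (a : nat -> C) (b : nat -> R) (l : C) (m : R) :
  Cseries a l -> is_series b m -> (forall n, Cmod (a n) <= b n) -> Cmod l <= m.
Proof.
intros Ha Hb Hab.
assert (H : is_series (fun n => Re (Cconj l * a n)%C) (Re (Cconj l * l)%C)).
{ apply (Cseries_scal (Cconj l)) in Ha. apply Cseries_components in Ha. apply Ha. }
assert (H2 : is_series (fun n => Cmod l * b n) (Cmod l * m)).
{ apply (is_series_scal (K := R_AbsRing) (V := R_NormedModule)) . exact Hb. }
assert (L : Re (Cconj l * l)%C <= Cmod l * m).
{ apply (is_lim_seq_le (sum_n (fun n => Re (Cconj l * a n)%C)) (sum_n (fun n => Cmod l * b n))
    (Finite _) (Finite _)); [|exact H|exact H2].
  intros n. apply sum_n_m_le. intros k.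
  eapply Rle_trans; [apply Rle_abs|]. eapply Rle_trans; [apply re_le_Cmod|].
  rewrite Cmod_mult, Cmod_conj. apply Rmult_le_compat_l; [apply Cmod_ge_0|apply Hab]. }
assert (E : Re (Cconj l * l)%C = Cmod l * Cmod l).
{ transitivity (Cmod l ^ 2); [rewrite Cmod2_alt|ring].
  destruct l; unfold Re, Im; simpl. ring. }
rewrite E in L.
assert (0 <= Cmod l) by apply Cmod_ge_0.
destruct (Req_dec (Cmod l) 0) as [Z|NZ].
- rewrite Z.
  apply (is_series_nonneg b m Hb). intros k. eapply Rle_trans; [apply Cmod_ge_0|apply Hab].
- apply Rmult_le_reg_l with (Cmod l); lra.
Qed.

(** Cauchy product, from its real counterpart applied to real and imaginary parts. *)
Lemma Cseries_mult (a b : nat -> C) (l m : C) :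
  Cseries a l -> Cseries b m ->
  ex_series (fun n => Cmod (a n)) -> ex_series (fun n => Cmod (b n)) ->
  Cseries (fun n => sum_n (G := C_AbelianMonoid) (fun k => a k * b (n - k)%nat)%C n) (l * m)%C.
Proof.
intros Ha Hb Ea Eb.
apply Cseries_components in Ha; destruct Ha as [Ha1 Ha2].
apply Cseries_components in Hb; destruct Hb as [Hb1 Hb2].
pose proof (ex_abs_Re a Ea) as Ar. pose proof (ex_abs_Im a Ea) as Ai.
pose proof (ex_abs_Re b Eb) as Br. pose proof (ex_abs_Im b Eb) as Bi.
apply Cseries_components. split.
- pose proof (is_series_minus _ _ _ _
    (is_series_mult _ _ _ _ Ha1 Hb1 Ar Br) (is_series_mult _ _ _ _ Ha2 Hb2 Ai Bi)) as H.
  replace (Re (l * m)%C) with (minus (Re l * Re m) (Im l * Im m)) by reflexivity.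
  revert H. apply is_series_ext. intros n.
  rewrite sum_n_Re, sum_n_Reals. change plus with Rplus. change (@opp R_NormedModule) with Ropp.
  fold (Rminus (sum_f_R0 (fun k => Re (a k) * Re (b (n - k)%nat)) n)
    (sum_f_R0 (fun k => Im (a k) * Im (b (n - k)%nat)) n)).
  rewrite <- minus_sum. apply sum_eq. intros k _. reflexivity.
- pose proof (is_series_plus _ _ _ _
    (is_series_mult _ _ _ _ Ha1 Hb2 Ar Bi) (is_series_mult _ _ _ _ Ha2 Hb1 Ai Br)) as H.
  replace (Im (l * m)%C) with (plus (Re l * Im m) (Im l * Re m)) by reflexivity.
  revert H. apply is_series_ext. intros n.
  rewrite sum_n_Im, sum_n_Reals. change plus with Rplus.
  rewrite <- plus_sum. apply sum_eq. intros k _. reflexivity.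
Qed.

(** ** Power series with coefficients of polynomial growth *)

(** The coefficients grow at most like a power of the index, so that the power series
    converges on the unit disc; the class is stable under termwise differentiation. *)
Definition poly_growth (a : nat -> C) : Prop :=
  exists (k : nat) (M : R), 0 <= M /\ forall n, Cmod (a n) <= M * INR (S n) ^ k.

Lemma ratio_lim : is_lim_seq (fun n => INR (S (S n)) / INR (S n)) 1.
Proof.
apply is_lim_seq_ext with (fun n => 1 + / INR (S n)).
{ intros n. rewrite (S_INR (S n)). field. apply not_0_INR; lia. }
replace (Finite 1) with (Finite (1 + 0)) by (f_equal; ring).
apply is_lim_seq_plus'; [apply is_lim_seq_const|].
apply (is_lim_seq_incr_1 (fun n => / INR n)).
apply (is_lim_seq_inv INR p_infty); [apply is_lim_seq_INR|discriminate].
Qed.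

Lemma ex_series_poly_geom (k : nat) (r : R) :
  0 <= r < 1 -> ex_series (fun n => INR (S n) ^ k * r ^ n).
Proof.
intros Hr.
set (s := (r + 1) / 2).
assert (Hs : 0 < s < 1) by (unfold s; lra).
assert (P : forall n, 0 < INR (S n)) by (intros; apply lt_0_INR; lia).
assert (Q : forall n, 0 < INR (S n) ^ k * s ^ n).
{ intros n. apply Rmult_lt_0_compat; apply pow_lt; [apply P|lra]. }
assert (E : ex_series (fun n => Rabs (INR (S n) ^ k * s ^ n))).
{ apply ex_series_DAlembert with s; [lra| |].
  - intros n. apply Rgt_not_eq, Q.
  - apply is_lim_seq_ext with (fun n => (INR (S (S n)) / INR (S n)) ^ k * s).
    + intros n. rewrite Rabs_pos_eq.
      * unfold Rdiv. rewrite Rpow_mult_distr, pow_inv. simpl (s ^ S n). field.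
        split; [apply Rgt_not_eq, pow_lt; lra|apply Rgt_not_eq, pow_lt, P].
      * left; apply Rdiv_lt_0_compat; apply Q.
    + replace (Finite s) with (Finite (1 ^ k * s)) by (rewrite pow1; f_equal; ring).
      apply is_lim_seq_mult'; [|apply is_lim_seq_const].
      induction k as [|k IH]; [apply is_lim_seq_const|].
      simpl. apply is_lim_seq_mult'; [apply ratio_lim|].
      apply IH. intros n. apply Rmult_lt_0_compat; apply pow_lt; [apply P|lra]. }
revert E. apply (ex_series_le (K := R_AbsRing) (V := R_CompleteNormedModule)).
intros n. change (Rabs (INR (S n) ^ k * r ^ n) <= Rabs (INR (S n) ^ k * s ^ n)).
rewrite !Rabs_pos_eq.
- apply Rmult_le_compat_l; [left; apply pow_lt, P|]. apply pow_incr; unfold s; lra.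
- left; apply Q.
- apply Rmult_le_pos; [left; apply pow_lt, P|apply pow_le; lra].
Qed.

Lemma growth_ex (a : nat -> C) (r : R) :
  poly_growth a -> 0 <= r < 1 -> ex_series (fun n => Cmod (a n) * r ^ n).
Proof.
intros [k [M [HM H]]] Hr.
apply (ex_series_le (K := R_AbsRing) (V := R_CompleteNormedModule)) with
  (fun n => M * (INR (S n) ^ k * r ^ n)).
- intros n. change (Rabs (Cmod (a n) * r ^ n) <= M * (INR (S n) ^ k * r ^ n)).
  assert (0 <= r ^ n) by (apply pow_le; lra).
  rewrite Rabs_pos_eq by (apply Rmult_le_pos; [apply Cmod_ge_0|assumption]).
  rewrite <- Rmult_assoc. apply Rmult_le_compat_r; [assumption|apply H].
- apply (ex_series_scal_l (K := R_AbsRing) (V := R_NormedModule) M (fun n => INR (S n) ^ k * r ^ n)). apply ex_series_poly_geom; exact Hr.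
Qed.

Lemma growth_ex_disc (a : nat -> C) (z : C) :
  poly_growth a -> unit_disc z -> ex_series (fun n => Cmod (a n * z ^ n)%C).
Proof.
intros Ha Hz. apply ex_series_ext with (fun n => Cmod (a n) * Cmod z ^ n).
- intros n. now rewrite Cmod_mult, Cmod_pow.
- apply growth_ex; [exact Ha|]. split; [apply Cmod_ge_0|exact Hz].
Qed.

(** Sum of the power series with coefficients [a], meaningful where it converges. *)
Definition CPS (a : nat -> C) (z : C) : C := CSum (fun n => a n * z ^ n)%C.

Lemma CPS_correct (a : nat -> C) (z : C) :
  poly_growth a -> unit_disc z -> Cseries (fun n => a n * z ^ n)%C (CPS a z).
Proof. intros Ha Hz. apply CSum_correct, growth_ex_disc; assumption. Qed.

Lemma CPS_unique (a : nat -> C) (z l : C) :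
  poly_growth a -> unit_disc z -> Cseries (fun n => a n * z ^ n)%C l -> CPS a z = l.
Proof.
intros Ha Hz H. apply (Cseries_unique _ _ _ (CPS_correct a z Ha Hz) H).
Qed.

Lemma CPS_0 (a : nat -> C) : poly_growth a -> CPS a 0 = a 0%nat.
Proof.
intros Ha. apply CPS_unique; [exact Ha|unfold unit_disc; rewrite Cmod_0; lra|].
apply (proj1 (Cseries_incr_1 _ _)). simpl.
replace (a 0%nat - a 0%nat * 1)%C with (0 * 0)%C by ring.
apply Cseries_ext with (fun n => 0 * 0)%C; [intros; ring|].
assert (Z : is_series (fun _ : nat => 0) 0).
{ apply filterlim_ext with (fun _ : nat => 0); [|apply filterlim_const].
  intros n. induction n as [|n IH]; [now rewrite sum_O|].
  rewrite sum_Sn, <- IH. symmetry; apply Rplus_0_l. }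
apply Cseries_components; split; simpl.
- replace (0 * 0 - 0 * 0) with 0 by ring. exact Z.
- replace (0 * 0 + 0 * 0) with 0 by ring. exact Z.
Qed.

Lemma growth_bounded (a : nat -> C) (M : R) : (forall n, Cmod (a n) <= M) -> poly_growth a.
Proof.
intros H. exists 0%nat, M. split.
- eapply Rle_trans; [apply Cmod_ge_0|apply (H 0%nat)].
- intros n. simpl. rewrite Rmult_1_r. apply H.
Qed.

Lemma growth_tail (a : nat -> C) : poly_growth a -> poly_growth (fun n => a (S n)).
Proof.
intros [k [M [HM H]]]. exists k, (M * 2 ^ k). split.
- apply Rmult_le_pos; [exact HM|apply pow_le; lra].
- intros n. eapply Rle_trans; [apply H|].
  rewrite Rmult_assoc, <- Rpow_mult_distr. apply Rmult_le_compat_l; [exact HM|].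
  apply pow_incr. split; [apply pos_INR|]. rewrite !S_INR. pose proof (pos_INR n). lra.
Qed.

(** Coefficients of the termwise derivative. *)
Definition PSd (a : nat -> C) (n : nat) : C := (INR (S n) * a (S n))%C.

Lemma growth_PSd (a : nat -> C) : poly_growth a -> poly_growth (PSd a).
Proof.
intros H. destruct (growth_tail a H) as [k [M [HM K]]].
exists (S k), M. split; [exact HM|].
intros n. unfold PSd. rewrite Cmod_mult, Cmod_R, Rabs_pos_eq by apply pos_INR.
replace (M * INR (S n) ^ S k) with (INR (S n) * (M * INR (S n) ^ k)) by (simpl; ring).
apply Rmult_le_compat_l; [apply pos_INR|apply K].
Qed.

(** Second-order remainder of z^(n+1); the factor [r] on the left avoids the exponent
    n - 1 on the right. *)
Lemma pow_increment (z h : C) (r : R) (n : nat) :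
  0 < r -> Cmod z <= r -> Cmod (z + h)%C <= r ->
  r * Cmod ((z + h) ^ S n - z ^ S n - INR (S n) * z ^ n * h)%C
    <= INR (S n) ^ 2 * r ^ n * Cmod h ^ 2.
Proof.
intros Hr Hz Hzh. induction n as [|n IH].
- replace ((z + h) ^ 1 - z ^ 1 - INR 1 * z ^ 0 * h)%C with (RtoC 0) by (simpl; ring).
  rewrite Cmod_0. simpl. pose proof (Cmod_ge_0 h). nra.
- set (D := ((z + h) ^ S n - z ^ S n - INR (S n) * z ^ n * h)%C) in *.
  replace ((z + h) ^ S (S n) - z ^ S (S n) - INR (S (S n)) * z ^ S n * h)%C
    with ((z + h) * D + INR (S n) * z ^ n * (h * h))%C.
  2:{ unfold D. rewrite (S_INR (S n)), RtoC_plus. rewrite !(Cpow_S _ (S n)), (Cpow_S z n). ring. }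
  assert (T : Cmod ((z + h) * D + INR (S n) * z ^ n * (h * h))%C <=
     r * Cmod D + INR (S n) * r ^ n * (Cmod h * Cmod h)).
  { eapply Rle_trans; [apply Cmod_triangle|]. rewrite !Cmod_mult, Cmod_pow, Cmod_R.
    rewrite (Rabs_pos_eq (INR (S n))) by apply pos_INR.
    apply Rplus_le_compat.
    - apply Rmult_le_compat_r; [apply Cmod_ge_0|exact Hzh].
    - apply Rmult_le_compat_r; [pose proof (Cmod_ge_0 h); nra|].
      apply Rmult_le_compat_l; [apply pos_INR|]. apply pow_incr. split; [apply Cmod_ge_0|exact Hz]. }
  apply Rle_trans with (r * (r * Cmod D + INR (S n) * r ^ n * (Cmod h * Cmod h))).
  { apply Rmult_le_compat_l; lra. }
  rewrite (S_INR (S n)). simpl (r ^ S n).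
  assert (0 <= r ^ n) by (apply pow_le; lra).
  assert (0 <= INR (S n)) by apply pos_INR.
  set (N := INR (S n)) in *. set (p := r ^ n) in *. set (m := Cmod h) in *.
  assert (0 <= p * m ^ 2) by (apply Rmult_le_pos; [assumption|apply pow2_ge_0]).
  assert (r * (r * Cmod D) <= r * (N ^ 2 * p * m ^ 2)) by (apply Rmult_le_compat_l; lra).
  assert (0 <= r * (p * m ^ 2) * (N + 1)).
  { apply Rmult_le_pos; [apply Rmult_le_pos; lra|lra]. }
  nra.
Qed.

(** A complex power series may be differentiated term by term: summing the bounds
    of [pow_increment], the remainder is at most a constant times |h|^2. *)
Lemma CPS_deriv (a : nat -> C) (z : C) :
  poly_growth a -> unit_disc z -> Cderiv (CPS a) z (CPS (PSd a) z).
Proof.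
intros Ha Hz. unfold unit_disc in Hz.
assert (Hz0 : 0 <= Cmod z) by apply Cmod_ge_0.
(* a radius strictly between |z| and 1 *)
set (r := (1 + Cmod z) / 2).
assert (Hr : 0 < r < 1 /\ Cmod z < r) by (unfold r; lra).
destruct Hr as [Hr Hzr].
set (b := fun n => (INR (S n) * PSd a n)%C).
assert (Hb : poly_growth b).
{ destruct (growth_PSd a Ha) as [k [M [HM K]]]. exists (S k), M. split; [exact HM|].
  intros n. unfold b. rewrite Cmod_mult, Cmod_R, Rabs_pos_eq by apply pos_INR.
  replace (M * INR (S n) ^ S k) with (INR (S n) * (M * INR (S n) ^ k)) by (simpl; ring).
  apply Rmult_le_compat_l; [apply pos_INR|apply K]. }
destruct (growth_ex b r Hb) as [S0 HS0]; [lra|].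
assert (S0pos : 0 <= S0).
{ apply (is_series_nonneg _ _ HS0). intros n. apply Rmult_le_pos; [apply Cmod_ge_0|apply pow_le; lra]. }
intros eps He.
exists (Rmin (r - Cmod z) (eps * r / (S0 + 1))). split.
{ apply Rmin_pos; [lra|]. apply Rdiv_lt_0_compat; [apply Rmult_lt_0_compat; lra|lra]. }
intros h Hh.
assert (h1 : Cmod h < r - Cmod z) by (apply Rlt_le_trans with (1 := Hh); apply Rmin_l).
assert (h2 : Cmod h < eps * r / (S0 + 1)) by (apply Rlt_le_trans with (1 := Hh); apply Rmin_r).
assert (Hzh : Cmod (z + h)%C <= r).
{ eapply Rle_trans; [apply Cmod_triangle|lra]. }
assert (Dzh : unit_disc (z + h)%C) by (unfold unit_disc; lra).
pose proof (proj2 (Cseries_incr_1 _ _) (CPS_correct a (z + h) Ha Dzh)) as H1.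
pose proof (proj2 (Cseries_incr_1 _ _) (CPS_correct a z Ha Hz)) as H2.
pose proof (CPS_correct (PSd a) z (growth_PSd a Ha) Hz) as H3.
apply (Cseries_scal h) in H3.
pose proof (Cseries_minus _ _ _ _ (Cseries_minus _ _ _ _ H1 H2) H3) as H. clear H1 H2 H3. cbv beta in H.
replace (CPS a (z + h) - a 0%nat * (z + h) ^ 0 - (CPS a z - a 0%nat * z ^ 0) - h * CPS (PSd a) z)%C
  with (CPS a (z + h) - CPS a z - CPS (PSd a) z * h)%C in H by (simpl; ring).
assert (B : Cmod (CPS a (z + h) - CPS a z - CPS (PSd a) z * h)%C <= Cmod h ^ 2 / r * S0).
{ eapply Cseries_bound; [exact H| |].
  - apply (is_series_scal (K := R_AbsRing) (V := R_NormedModule) (Cmod h ^ 2 / r)). exact HS0.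
  - intros n.
    match goal with |- ?x <= _ => change (x <= Cmod h ^ 2 / r * (Cmod (b n) * r ^ n)) end.
    cbv beta.
    replace (a (S n) * (z + h) ^ S n - a (S n) * z ^ S n - h * (PSd a n * z ^ n))%C
      with (a (S n) * ((z + h) ^ S n - z ^ S n - INR (S n) * z ^ n * h))%C by (unfold PSd; ring).
    rewrite Cmod_mult. unfold b, PSd. rewrite !Cmod_mult, Cmod_R, Rabs_pos_eq by apply pos_INR.
    pose proof (pow_increment z h r n (proj1 Hr) (Rlt_le _ _ Hzr) Hzh) as P.
    apply Rmult_le_reg_l with r; [lra|].
    replace (r * (Cmod h ^ 2 / r * (INR (S n) * (INR (S n) * Cmod (a (S n))) * r ^ n)))
      with (Cmod (a (S n)) * (INR (S n) ^ 2 * r ^ n * Cmod h ^ 2)) by (field; lra).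
    match goal with |- r * (?x * ?y) <= _ => replace (r * (x * y)) with (x * (r * y)) by ring end.
    apply Rmult_le_compat_l; [apply Cmod_ge_0|exact P]. }
eapply Rle_trans; [exact B|].
assert (0 <= Cmod h) by apply Cmod_ge_0.
replace (Cmod h ^ 2 / r * S0) with (Cmod h * S0 / r * Cmod h) by (field; lra).
apply Rmult_le_compat_r; [assumption|].
apply Rle_div_l; [lra|].
apply Rlt_div_r in h2; [|lra].
nra.
Qed.

Lemma CPS_mult (a b : nat -> C) (z : C) :
  poly_growth a -> poly_growth b -> unit_disc z ->
  Cseries (fun n => sum_n (G := C_AbelianMonoid) (fun k => a k * b (n - k)%nat)%C n * z ^ n)%C
    (CPS a z * CPS b z)%C.
Proof.
intros Ha Hb Hz.
pose proof (Cseries_mult _ _ _ _ (CPS_correct a z Ha Hz) (CPS_correct b z Hb Hz)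
  (growth_ex_disc a z Ha Hz) (growth_ex_disc b z Hb Hz)) as H.
revert H. apply Cseries_ext. intros n.
assert (E : forall c (u : nat -> C) m, (sum_n (G := C_AbelianMonoid) u m * c)%C
   = sum_n (G := C_AbelianMonoid) (fun k => u k * c)%C m).
{ intros c u m. apply (eq_sym (sum_n_mult_r (K := C_Ring) c u m)). }
rewrite E. unfold sum_n. apply sum_n_m_ext_loc. intros k Hk.
change ((a k * z ^ k * (b (n - k)%nat * z ^ (n - k)) = a k * b (n - k)%nat * z ^ n)%C).
replace (z ^ n)%C with (z ^ k * z ^ (n - k))%C by (rewrite <- Cpow_add_r; f_equal; lia).
ring.
Qed.

Lemma Cseries_pow_shift (a : nat -> C) (z l : C) :
  Cseries (fun n => a n * z ^ n)%C l ->
  Cseries (fun n => match n with O => 0 | S m => a m end * z ^ n)%C (z * l)%C.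
Proof.
intros H. apply (proj1 (Cseries_incr_1 _ _)).
replace (z * l - 0 * z ^ 0)%C with (z * l)%C by ring.
apply (Cseries_scal z) in H. revert H. apply Cseries_ext. intros n. simpl. ring.
Qed.

(** The coefficients n a_n belong to z y', where y is the sum of the series. *)
Lemma Cseries_euler (a : nat -> C) (z : C) : poly_growth a -> unit_disc z ->
  Cseries (fun n => INR n * a n * z ^ n)%C (z * CPS (PSd a) z)%C.
Proof.
intros Ha Hz.
generalize (Cseries_pow_shift _ z _ (CPS_correct (PSd a) z (growth_PSd a Ha) Hz)).
apply Cseries_ext. intros [|n]; unfold PSd; simpl (INR 0); ring.
Qed.

Lemma pow_n_Cpow (z : C) (n : nat) : pow_n (K := C_Ring) z n = (z ^ n)%C.
Proof.
induction n as [|n IH]; [reflexivity|].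
simpl. rewrite IH. reflexivity.
Qed.

Lemma is_pseries_Cseries (a : nat -> C) (z l : C) :
  is_pseries (K := C_AbsRing) (V := C_NormedModule) a z l <->
  Cseries (fun n => a n * z ^ n)%C l.
Proof.
assert (E : forall n, scal (K := C_Ring) (V := C_ModuleSpace) (pow_n (K := C_Ring) z n) (a n) = (a n * z ^ n)%C).
{ intros n. rewrite pow_n_Cpow. apply Cmult_comm. }
split; apply (is_series_ext (V := C_NormedModule)); intros n; [|symmetry]; apply E.
Qed.

Lemma CPS_tail (a : nat -> C) (z : C) : poly_growth a -> unit_disc z ->
  CPS a z = (a 0%nat + z * CPS (fun n => a (S n)) z)%C.
Proof.
intros Ha Hz. apply CPS_unique; [exact Ha|exact Hz|].
apply (proj1 (Cseries_incr_1 _ _)). cbv beta.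
replace (a 0%nat + z * CPS (fun n => a (S n)) z - a 0%nat * z ^ 0)%C
  with (z * CPS (fun n => a (S n)) z)%C by (simpl; ring).
generalize (Cseries_scal z _ _ (CPS_correct _ z (growth_tail a Ha) Hz)). apply Cseries_ext.
intros n. simpl. ring.
Qed.

Lemma CPS_ext (a b : nat -> C) (z : C) : poly_growth a -> poly_growth b -> unit_disc z ->
  (forall n, a n = b n) -> CPS a z = CPS b z.
Proof.
intros Ha Hb Hz E. apply CPS_unique; [exact Ha|exact Hz|].
generalize (CPS_correct b z Hb Hz). apply Cseries_ext. intros n. now rewrite E.
Qed.

Lemma CPS_zero (z : C) : unit_disc z -> CPS (fun _ => RtoC 0) z = 0.
Proof.
intros Hz.
assert (G : poly_growth (fun _ => RtoC 0)).
{ apply growth_bounded with 0. intros _. rewrite Cmod_0. lra. }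
apply CPS_unique; [exact G|exact Hz|].
generalize (Cseries_scal 0 _ _ (CPS_correct _ z G Hz)). rewrite Cmult_0_l.
apply Cseries_ext. intros n. ring.
Qed.


(** * Smooth functions, the maximum principle and Schwarz's lemma *)

(** [f] has [n] successive complex derivatives at all points of [U]. *)
Fixpoint Csmooth (n : nat) (U : C -> Prop) (f : C -> C) : Prop :=
  match n with
  | O => True
  | S m => exists f' : C -> C, (forall z, U z -> Cderiv f z (f' z)) /\ Csmooth m U f'
  end.

Lemma Csmooth_sub (n : nat) (U V : C -> Prop) (f : C -> C) :
  (forall z, V z -> U z) -> Csmooth n U f -> Csmooth n V f.
Proof.
intros HUV; revert f; induction n as [|n IH]; intros f; simpl; [auto|].
intros [f' [H1 H2]]. exists f'. split; auto.
Qed.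

Lemma Csmooth_pred (n : nat) (U : C -> Prop) (f : C -> C) :
  Csmooth (S n) U f -> Csmooth n U f.
Proof.
revert f; induction n as [|n IH]; intros f; [simpl; auto|].
intros [f' [H1 H2]]. exists f'. split; [exact H1|]. apply IH; exact H2.
Qed.

Lemma Csmooth_const (n : nat) (U : C -> Prop) (c : C) : Csmooth n U (fun _ => c).
Proof.
revert c; induction n as [|n IH]; intros c; simpl; [auto|].
exists (fun _ => RtoC 0). split; [intros; apply Cderiv_const|apply IH].
Qed.

Lemma Csmooth_id (n : nat) (U : C -> Prop) : Csmooth n U (fun z => z).
Proof.
destruct n as [|n]; simpl; [auto|].
exists (fun _ => RtoC 1). split; [intros; apply Cderiv_id|apply Csmooth_const].
Qed.

Lemma Csmooth_plus (n : nat) (U : C -> Prop) (f g : C -> C) :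
  Csmooth n U f -> Csmooth n U g -> Csmooth n U (fun z => f z + g z)%C.
Proof.
revert f g; induction n as [|n IH]; intros f g; simpl; [auto|].
intros [f' [F1 F2]] [g' [G1 G2]]. exists (fun z => f' z + g' z)%C.
split; [intros; apply Cderiv_plus; auto|apply IH; auto].
Qed.

Lemma Csmooth_mult (n : nat) (U : C -> Prop) (f g : C -> C) :
  Csmooth n U f -> Csmooth n U g -> Csmooth n U (fun z => f z * g z)%C.
Proof.
revert f g; induction n as [|n IH]; intros f g; [simpl; auto|].
intros F G. pose proof (Csmooth_pred _ _ _ F) as F0. pose proof (Csmooth_pred _ _ _ G) as G0.
destruct F as [f' [F1 F2]], G as [g' [G1 G2]].
exists (fun z => f' z * g z + f z * g' z)%C. split.
- intros; apply Cderiv_mult; auto.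
- apply Csmooth_plus; apply IH; auto.
Qed.

Lemma Csmooth_scal (n : nat) (U : C -> Prop) (c : C) (f : C -> C) :
  Csmooth n U f -> Csmooth n U (fun z => c * f z)%C.
Proof. intros H. apply Csmooth_mult; [apply Csmooth_const|exact H]. Qed.

Lemma Csmooth_minus (n : nat) (U : C -> Prop) (f g : C -> C) :
  Csmooth n U f -> Csmooth n U g -> Csmooth n U (fun z => f z - g z)%C.
Proof.
revert f g; induction n as [|n IH]; intros f g; simpl; [auto|].
intros [f' [F1 F2]] [g' [G1 G2]]. exists (fun z => f' z - g' z)%C.
split; [intros; apply Cderiv_minus; auto|apply IH; auto].
Qed.

Lemma Csmooth_inv (n : nat) (U : C -> Prop) (f : C -> C) :
  (forall z, U z -> f z <> 0) -> Csmooth n U f -> Csmooth n U (fun z => / f z)%C.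
Proof.
intros N; revert f N; induction n as [|n IH]; intros f N; [simpl; auto|].
intros F. pose proof (Csmooth_pred _ _ _ F) as F0. destruct F as [f' [F1 F2]].
exists (fun z => - (1) * (f' z * (/ f z * / f z)))%C. split.
- intros z Hz.
  replace (- (1) * (f' z * (/ f z * / f z)))%C with (- f' z / (f z * f z))%C by (field; auto).
  apply Cderiv_inv; auto.
- apply Csmooth_scal, Csmooth_mult; [exact F2|]. apply Csmooth_mult; apply IH; auto.
Qed.

Lemma Csmooth_CPS (n : nat) (a : nat -> C) : poly_growth a -> Csmooth n unit_disc (CPS a).
Proof.
revert a; induction n as [|n IH]; intros a Ha; simpl; [auto|].
exists (CPS (PSd a)). split; [intros; apply CPS_deriv; auto|apply IH, growth_PSd, Ha].
Qed.

(** ** Taylor expansions *)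

(** [r t] is o(t^n) as [t] tends to 0. *)
Definition little_o (n : nat) (r : C -> C) : Prop :=
  forall eps, 0 < eps -> exists d, 0 < d /\
    forall t, Cmod t < d -> Cmod (r t) <= eps * Cmod t ^ n.

(** Integrating a remainder raises its order by one. *)
Lemma little_o_primitive (n : nat) (r r' : C -> C) (d0 : R) :
  0 < d0 -> (forall t, Cmod t < d0 -> Cderiv r t (r' t)) -> r 0 = 0 ->
  little_o n r' -> little_o (S n) r.
Proof.
intros Hd0 D R0 H eps He. destruct (H eps He) as [d [Hd Hr]].
exists (Rmin d d0). split; [apply Rmin_pos; assumption|].
intros t Ht.
assert (t1 : Cmod t < d) by (apply Rlt_le_trans with (1 := Ht); apply Rmin_l).
assert (t2 : Cmod t < d0) by (apply Rlt_le_trans with (1 := Ht); apply Rmin_r).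
replace (r t) with (r (0 + t) - r 0)%C by (rewrite R0, Cplus_0_l; ring).
replace (eps * Cmod t ^ S n) with (eps * Cmod t ^ n * Cmod t) by (simpl; ring).
apply (mean_value_ineq r r'); intros s Hs; rewrite Cplus_0_l;
  pose proof (Cmod_scal_le s t Hs) as L.
- apply D. lra.
- eapply Rle_trans; [apply Hr; lra|]. apply Rmult_le_compat_l; [lra|].
  apply pow_incr. split; [apply Cmod_ge_0|exact L].
Qed.

Lemma Cderiv_shift (f : C -> C) (z t l : C) :
  Cderiv f (z + t) l -> Cderiv (fun s => f (z + s)%C) t l.
Proof.
intros H. replace l with (l * (0 + 1))%C by ring.
apply (Cderiv_comp f (fun s => z + s)%C); [exact H|].
apply Cderiv_plus; [apply Cderiv_const|apply Cderiv_id].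
Qed.

Lemma taylor_2 (U : C -> Prop) (g : C -> C) (z : C) (d : R) :
  0 < d -> (forall t, Cmod t < d -> U (z + t)%C) -> Csmooth 2 U g ->
  exists a b : C, little_o 2 (fun t => g (z + t) - (g z + a * t + b * (t * t)))%C.
Proof.
intros Hd HU [g1 [D1 [g2 [D2 _]]]].
exists (g1 z), (/ 2 * g2 z)%C.
assert (Hz : U z).
{ replace z with (z + 0)%C by ring. apply HU. rewrite Cmod_0; exact Hd. }
apply little_o_primitive with (fun t => g1 (z + t) - (0 + g1 z * 1 + / 2 * g2 z * (2 * t)))%C d.
- exact Hd.
- intros t Ht. apply Cderiv_minus; [apply Cderiv_shift, D1, HU, Ht|].
  apply Cderiv_plus; [apply Cderiv_plus; [apply Cderiv_const|]|].
  + apply Cderiv_scal, Cderiv_id.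
  + apply Cderiv_scal, Cderiv_sqr.
- rewrite Cplus_0_r. ring.
- intros eps He. destruct (D2 z Hz eps He) as [d' [Hd' H]].
  exists d'. split; [exact Hd'|]. intros t Ht. rewrite pow_1.
  replace (g1 (z + t) - (0 + g1 z * 1 + / 2 * g2 z * (2 * t)))%C
    with (g1 (z + t) - g1 z - g2 z * t)%C by (field; apply RtoC_neq_0; lra).
  apply H; exact Ht.
Qed.

(** Second-order expansion of the difference quotient at 0: divide the
    third-order expansion of [g] by [t]. *)
Lemma taylor_quotient (U : C -> Prop) (g g1 : C -> C) (d : R) :
  0 < d -> (forall t, Cmod t < d -> U t) -> g 0 = 0 ->
  (forall z, U z -> Cderiv g z (g1 z)) -> Csmooth 2 U g1 ->
  exists a b : C, forall eps, 0 < eps -> exists d', 0 < d' /\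
    forall t, Cmod t < d' -> t <> 0 ->
      Cmod (g t / t - (g1 0 + a * t + b * (t * t)))%C <= eps * Cmod t ^ 2.
Proof.
intros Hd HU G0 D1 S2.
destruct (taylor_2 U g1 0 d Hd) as [a [b H]]; [|exact S2|].
{ intros t Ht. rewrite Cplus_0_l. apply HU; exact Ht. }
exists (/ 2 * a)%C, (/ 3 * b)%C.
assert (K : little_o 3 (fun t => g t - (g1 0 * t + (/ 2 * a) * (t * t) + (/ 3 * b) * (t * (t * t))))%C).
{ apply little_o_primitive with
    (fun t => g1 t - (g1 0 * 1 + (/ 2 * a) * (2 * t) + (/ 3 * b) * (1 * (t * t) + t * (2 * t))))%C d.
  - exact Hd.
  - intros t Ht. apply Cderiv_minus; [apply D1, HU, Ht|].
    apply Cderiv_plus; [apply Cderiv_plus; apply Cderiv_scal|].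
    + apply Cderiv_id.
    + apply Cderiv_sqr.
    + apply Cderiv_scal. apply (Cderiv_mult (fun t => t) (fun t => t * t)%C);
        [apply Cderiv_id|apply Cderiv_sqr].
  - rewrite G0. ring.
  - intros eps He. destruct (H eps He) as [d' [Hd' H']]. exists d'. split; [exact Hd'|].
    intros t Ht. specialize (H' t Ht). rewrite Cplus_0_l in H'.
    replace (g1 t - (g1 0 * 1 + / 2 * a * (2 * t) + / 3 * b * (1 * (t * t) + t * (2 * t))))%C
      with (g1 t - (g1 0 + a * t + b * (t * t)))%C
      by (field; split; apply RtoC_neq_0; lra).
    exact H'. }
intros eps He. destruct (K eps He) as [d' [Hd' H']]. exists d'. split; [exact Hd'|].
intros t Ht Nt. specialize (H' t Ht).
replace (g t / t - (g1 0 + / 2 * a * t + / 3 * b * (t * t)))%C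
  with ((g t - (g1 0 * t + / 2 * a * (t * t) + / 3 * b * (t * (t * t)))) / t)%C
  by (field; repeat split; first [exact Nt | apply RtoC_neq_0; lra]).
assert (Pt : 0 < Cmod t) by (apply Cmod_gt_0; exact Nt).
rewrite Cmod_div by exact Nt. apply Rle_div_l; [exact Pt|].
replace (eps * Cmod t ^ 2 * Cmod t) with (eps * Cmod t ^ 3) by ring. exact H'.
Qed.

(** ** Compactness of closed discs *)

Lemma Cmod_lt_components (x y d : R) : Rabs x < d / 2 -> Rabs y < d / 2 -> Cmod (x, y) < d.
Proof.
intros Hx Hy.
replace ((x, y) : C) with (x + Ci * y)%C.
2:{ unfold Ci, Cplus, Cmult; simpl. f_equal; ring. }
eapply Rle_lt_trans; [apply Cmod_triangle|].
rewrite Cmod_mult, Cmod_Ci, !Cmod_R. lra.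
Qed.

(** A property holding locally uniformly on a closed disc holds uniformly:
    the parameter of the property also serves as the radius of the
    neighbourhood on which it holds. *)
Lemma disc_gauge (rho : R) (Q : R -> C -> Prop) :
  (forall d d' z, 0 < d' <= d -> Q d z -> Q d' z) ->
  (forall z, Cmod z <= rho -> exists d, 0 < d /\
     forall z', Cmod z' <= rho -> Cmod (z' - z)%C < d -> Q d z') ->
  exists d, 0 < d /\ forall z, Cmod z <= rho -> Q d z.
Proof.
intros Mono Loc.
(* Points of the square outside the disc get a neighbourhood missing the disc; the
   factor 2 passes from the sup norm of the plane to [Cmod]. *)
assert (G : forall z : C, exists d : posreal,
   forall z', Cmod z' <= rho -> Cmod (z' - z)%C < 2 * d -> Q d z').
{ intros z. destruct (Rle_dec (Cmod z) rho) as [Hz|Hz].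
  - destruct (Loc z Hz) as [d [Hd H]].
    assert (Hd2 : 0 < d / 2) by lra. exists (mkposreal _ Hd2). simpl.
    intros z' H1 H2. apply Mono with d; [lra|]. apply H; [exact H1|lra].
  - assert (Hd : 0 < (Cmod z - rho) / 2) by lra. exists (mkposreal _ Hd). simpl.
    intros z' H1 H2. exfalso.
    assert (Cmod z <= Cmod z' + Cmod (z' - z)%C).
    { replace z with (z' + - (z' - z))%C at 1 by ring.
      rewrite <- (Cmod_opp (z' - z)%C). apply Cmod_triangle. }
    lra. }
set (delta := fun x y : R => proj1_sig (constructive_indefinite_description _ (G (x, y)))).
assert (Hdelta : forall x y z', Cmod z' <= rho -> Cmod (z' - (x, y))%C < 2 * delta x y -> Q (delta x y) z').
{ intros x y. unfold delta. destruct (constructive_indefinite_description _ (G (x, y))) as [d H]. exact H. }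
destruct (compactness_value_2d (- rho) rho (- rho) rho delta) as [d Hd].
exists d. split; [apply cond_pos|].
intros z Hz. apply NNPP. intros NQ.
assert (B : Rabs (Re z) <= rho /\ Rabs (Im z) <= rho).
{ split; [pose proof (re_le_Cmod z)|pose proof (im_le_Cmod z)]; lra. }
destruct B as [B1 B2].
apply (Hd (Re z) (Im z)).
- split; [apply Rabs_le_between in B1|apply Rabs_le_between in B1]; lra.
- apply Rabs_le_between in B2; lra.
- intros [u [v [_ [_ [H1 [H2 H3]]]]]]. apply NQ.
  apply Mono with (delta u v); [split; [apply cond_pos|exact H3]|].
  apply Hdelta; [exact Hz|].
  replace (z - (u, v))%C with ((Re z - u, Im z - v) : C) by (destruct z; reflexivity).
  apply Cmod_lt_components; lra.
Qed.

(** A continuous real function attains its maximum on a closed disc. *)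
Lemma disc_max (rho : R) (F : C -> R) :
  0 <= rho ->
  (forall z, Cmod z <= rho -> forall eps, 0 < eps -> exists d, 0 < d /\
     forall z', Cmod (z' - z)%C < d -> Rabs (F z' - F z) < eps) ->
  exists z0, Cmod z0 <= rho /\ forall z, Cmod z <= rho -> F z <= F z0.
Proof.
intros Hrho Hc.
assert (Bd : exists d, 0 < d /\ forall z, Cmod z <= rho -> F z <= / d).
{ apply (disc_gauge rho (fun d z => F z <= / d)).
  - intros d d' z Hd H. eapply Rle_trans; [exact H|]. apply Rinv_le_contravar; lra.
  - intros z Hz. destruct (Hc z Hz 1) as [d1 [Hd1 H1]]; [lra|].
    assert (P : 0 < Rabs (F z) + 1) by (pose proof (Rabs_pos (F z)); lra).
    assert (P' : 0 < / (Rabs (F z) + 1)) by (apply Rinv_0_lt_compat; exact P).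
    exists (Rmin d1 (/ (Rabs (F z) + 1))). split; [apply Rmin_pos; assumption|].
    intros z' _ Hz'. apply Rle_trans with (Rabs (F z) + 1).
    + assert (A : Rabs (F z' - F z) < 1).
      { apply H1. apply Rlt_le_trans with (1 := Hz'); apply Rmin_l. }
      apply Rabs_def2 in A. pose proof (Rle_abs (F z)). lra.
    + rewrite <- (Rinv_inv (Rabs (F z) + 1)) at 1. apply Rinv_le_contravar.
      * apply Rmin_pos; assumption.
      * apply Rmin_r. }
destruct Bd as [d [Hd HB]].
destruct (completeness (fun x => exists z, Cmod z <= rho /\ x = F z)) as [S [US LS]].
- exists (/ d). intros x [z [Hz Ex]]. rewrite Ex. apply HB; exact Hz.
- exists (F 0), 0. split; [rewrite Cmod_0; exact Hrho|reflexivity].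
- apply NNPP. intros NM.
  assert (Lt : forall z, Cmod z <= rho -> F z < S).
  { intros z Hz. destruct (Rle_lt_or_eq_dec (F z) S) as [L|E]; [|exact L|].
    - apply US. exists z; auto.
    - exfalso. apply NM. exists z. split; [exact Hz|]. intros z' Hz'. rewrite E.
      apply US. exists z'; auto. }
  destruct (disc_gauge rho (fun d z => F z <= S - d)) as [e [He HS]].
  + intros d1 d' z H1 H. lra.
  + intros z Hz. specialize (Lt z Hz).
    destruct (Hc z Hz ((S - F z) / 2)) as [d1 [Hd1 H1]]; [lra|].
    exists (Rmin d1 ((S - F z) / 2)). split; [apply Rmin_pos; lra|].
    intros z' _ Hz'.
    assert (A : Rabs (F z' - F z) < (S - F z) / 2).
    { apply H1. apply Rlt_le_trans with (1 := Hz'); apply Rmin_l. }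
    apply Rabs_def2 in A. pose proof (Rmin_r d1 ((S - F z) / 2)). lra.
  + assert (S <= S - e); [|lra].
    apply LS. intros x [z [Hz Ex]]. rewrite Ex. apply HS; exact Hz.
Qed.

(** ** The maximum principle *)

(** [h] has a second-order complex expansion at [z]. *)
Definition expands_2 (h : C -> C) (z : C) : Prop :=
  exists a b : C, little_o 2 (fun t => h (z + t) - (h z + a * t + b * (t * t)))%C.

Lemma expands_2_cont (h : C -> C) (z : C) : expands_2 h z -> Ccont h z.
Proof.
intros [a [b H]]. apply Cderiv_cont with a.
intros eps He.
destruct (H (eps / 2)) as [d [Hd Hr]]; [lra|].
assert (K : 0 < 2 * (Cmod b + 1)) by (pose proof (Cmod_ge_0 b); lra).
exists (Rmin (Rmin d 1) (eps / (2 * (Cmod b + 1)))). split.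
{ apply Rmin_pos; [apply Rmin_pos; lra|apply Rdiv_lt_0_compat; lra]. }
intros t Ht.
assert (t1 : Cmod t < d) by (apply Rlt_le_trans with (1 := Ht); eapply Rle_trans; [apply Rmin_l|apply Rmin_l]).
assert (t2 : Cmod t < 1) by (apply Rlt_le_trans with (1 := Ht); eapply Rle_trans; [apply Rmin_l|apply Rmin_r]).
assert (t3 : Cmod t < eps / (2 * (Cmod b + 1))) by (apply Rlt_le_trans with (1 := Ht); apply Rmin_r).
specialize (Hr t t1).
replace (h (z + t) - h z - a * t)%C
  with ((h (z + t) - (h z + a * t + b * (t * t))) + b * (t * t))%C by ring.
eapply Rle_trans; [apply Cmod_triangle|]. rewrite !Cmod_mult.
apply Rlt_div_r in t3; [|exact K].
pose proof (Cmod_ge_0 t). pose proof (Cmod_ge_0 b).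
assert (Cmod t ^ 2 <= Cmod t) by nra.
assert (eps / 2 * Cmod t ^ 2 <= eps / 2 * Cmod t) by (apply Rmult_le_compat_l; lra).
assert (Cmod b * Cmod t <= eps / 2) by nra.
assert (Cmod b * (Cmod t * Cmod t) <= eps / 2 * Cmod t).
{ rewrite <- Rmult_assoc. apply Rmult_le_compat_r; assumption. }
lra.
Qed.

Lemma Cmod_sqr_perturb (p r : C) : Cmod p ^ 2 - 2 * Cmod p * Cmod r <= Cmod (p + r)%C ^ 2.
Proof.
assert (H : Cmod p <= Cmod (p + r)%C + Cmod r).
{ replace p with ((p + r) + - r)%C at 1 by ring. rewrite <- (Cmod_opp r). apply Cmod_triangle. }
pose proof (Cmod_ge_0 p). pose proof (Cmod_ge_0 r). pose proof (Cmod_ge_0 (p + r)%C).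
destruct (Rle_dec (Cmod p) (Cmod r)); nra.
Qed.

(** Averaging over the four directions s, is, -s, -is kills all the cross terms
    of a quadratic polynomial. *)
Lemma four_point_quadratic (a b c : C) (s : R) :
  Cmod (a + b * s + c * (s * s))%C ^ 2
  + Cmod (a + b * (Ci * s) + c * (Ci * s * (Ci * s)))%C ^ 2
  + Cmod (a + b * (- s) + c * (- s * - s))%C ^ 2
  + Cmod (a + b * (- Ci * s) + c * (- Ci * s * (- Ci * s)))%C ^ 2
  = 4 * Cmod a ^ 2 + 4 * Cmod b ^ 2 * s ^ 2 + 4 * Cmod c ^ 2 * s ^ 4.
Proof.
rewrite !Cmod2_alt. destruct a, b, c. unfold Re, Im; simpl. ring.
Qed.

(** The maximum principle on closed discs.  For each e > 0 the function
    |h|^2 + e|z|^2 attains its maximum on the disc; at an interior maximum its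
    sum over four symmetric neighbours could not exceed four times its value,
    whereas the expansion of [h] shows that it does. *)
Lemma maximum_principle (h : C -> C) (rho M : R) :
  0 < rho -> 0 <= M ->
  (forall z, Cmod z <= rho -> expands_2 h z) ->
  (forall z, Cmod z = rho -> Cmod (h z) <= M) ->
  forall z, Cmod z <= rho -> Cmod (h z) <= M.
Proof.
intros Hrho HM Hexp Hbd z1 Hz1.
assert (K : forall e, 0 < e -> Cmod (h z1) ^ 2 <= M ^ 2 + e * rho ^ 2).
{ intros e He.
  set (F := fun z => Cmod (h z) ^ 2 + e * Cmod z ^ 2).
  destruct (disc_max rho F) as [z0 [Hz0 Hmax]]; [lra| |].
  { intros z Hz eps Heps.
    assert (Cm : forall f, Ccont f z -> forall eps, 0 < eps -> exists d, 0 < d /\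
       forall z', Cmod (z' - z)%C < d -> Rabs (Cmod (f z') ^ 2 - Cmod (f z) ^ 2) < eps).
    { clear eps Heps. intros f Hf eps Heps.
      set (k := 2 * Cmod (f z) + 1).
      assert (Hk : 0 < k) by (unfold k; pose proof (Cmod_ge_0 (f z)); lra).
      destruct (Hf (Rmin 1 (eps / k))) as [d [Hd H]].
      { apply Rmin_pos; [lra|apply Rdiv_lt_0_compat; lra]. }
      exists d. split; [exact Hd|]. intros z' Hz'. specialize (H _ Hz').
      replace (z + (z' - z))%C with z' in H by ring.
      set (w := (f z' - f z)%C) in *.
      assert (w1 : Cmod w < 1) by (apply Rlt_le_trans with (1 := H); apply Rmin_l).
      assert (w2 : Cmod w < eps / k) by (apply Rlt_le_trans with (1 := H); apply Rmin_r).
      assert (U1 : Cmod (f z') <= Cmod (f z) + Cmod w).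
      { replace (f z') with (f z + w)%C by (unfold w; ring). apply Cmod_triangle. }
      assert (U2 : Cmod (f z) <= Cmod (f z') + Cmod w).
      { replace (f z) with (f z' + - w)%C by (unfold w; ring).
        rewrite <- (Cmod_opp w). apply Cmod_triangle. }
      apply Rlt_div_r in w2; [|exact Hk].
      pose proof (Cmod_ge_0 (f z)). pose proof (Cmod_ge_0 (f z')). pose proof (Cmod_ge_0 w).
      unfold k in w2.
      apply Rabs_def1; nra. }
    destruct (Cm h (expands_2_cont h z (Hexp z Hz)) (eps / 2)) as [d1 [Hd1 H1]]; [lra|].
    destruct (Cm (fun z => z) (Cderiv_cont _ _ _ (Cderiv_id z)) (eps / (2 * e))) as [d2 [Hd2 H2]].
    { apply Rdiv_lt_0_compat; lra. }
    exists (Rmin d1 d2). split; [apply Rmin_pos; assumption|].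
    intros z' Hz'.
    assert (A1 : Cmod (z' - z)%C < d1) by (apply Rlt_le_trans with (1 := Hz'); apply Rmin_l).
    assert (A2 : Cmod (z' - z)%C < d2) by (apply Rlt_le_trans with (1 := Hz'); apply Rmin_r).
    specialize (H1 _ A1). specialize (H2 _ A2). cbv beta in H2.
    unfold F.
    replace (Cmod (h z') ^ 2 + e * Cmod z' ^ 2 - (Cmod (h z) ^ 2 + e * Cmod z ^ 2))
      with ((Cmod (h z') ^ 2 - Cmod (h z) ^ 2) + e * (Cmod z' ^ 2 - Cmod z ^ 2)) by ring.
    eapply Rle_lt_trans; [apply Rabs_triang|]. rewrite Rabs_mult, (Rabs_pos_eq e) by lra.
    apply Rlt_div_r in H2; [|lra]. lra. }
  assert (Hz0eq : Cmod z0 = rho).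
  { apply NNPP. intros Nz0.
    destruct (Hexp z0 Hz0) as [b [c Hexp0]].
    set (a := h z0) in *.
    (* [k] bounds the quadratic polynomial on |t| <= 1; [eta] is chosen so that the
       remainders cost 2 e s^2 in total, less than the gain 4 e s^2 from e|z|^2. *)
    set (k := Cmod a + Cmod b + Cmod c + 1).
    assert (Hk : 1 <= k).
    { unfold k. pose proof (Cmod_ge_0 a). pose proof (Cmod_ge_0 b). pose proof (Cmod_ge_0 c). lra. }
    set (eta := e / (4 * k)).
    assert (Heta : 0 < eta) by (apply Rdiv_lt_0_compat; lra).
    destruct (Hexp0 eta Heta) as [d [Hd Hr]].
    set (s := Rmin (d / 2) (Rmin 1 (rho - Cmod z0))).
    assert (Hs : 0 < s).
    { apply Rmin_pos; [lra|]. apply Rmin_pos; lra. }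
    assert (s1 : s < d) by (unfold s; pose proof (Rmin_l (d / 2) (Rmin 1 (rho - Cmod z0))); lra).
    assert (s2 : s <= 1) by (unfold s; eapply Rle_trans; [apply Rmin_r|apply Rmin_l]).
    assert (s3 : s <= rho - Cmod z0) by (unfold s; eapply Rle_trans; [apply Rmin_r|apply Rmin_r]).
    assert (Low : forall t, Cmod t = s ->
      Cmod (a + b * t + c * (t * t))%C ^ 2 - 2 * k * (eta * s ^ 2) + e * Cmod (z0 + t)%C ^ 2
      <= Cmod a ^ 2 + e * Cmod z0 ^ 2).
    { intros t Ht.
      assert (Hin : Cmod (z0 + t)%C <= rho).
      { eapply Rle_trans; [apply Cmod_triangle|]. lra. }
      pose proof (Hmax _ Hin) as HF. unfold F in HF. fold a in HF.
      assert (td : Cmod t < d) by lra.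
      specialize (Hr t td). rewrite Ht in Hr.
      pose proof (Cmod_sqr_perturb (a + b * t + c * (t * t))
        (h (z0 + t) - (a + b * t + c * (t * t))))%C as P.
      replace (a + b * t + c * (t * t) + (h (z0 + t) - (a + b * t + c * (t * t))))%C
        with (h (z0 + t)%C) in P by ring.
      assert (Pk : Cmod (a + b * t + c * (t * t))%C <= k).
      { eapply Rle_trans; [apply Cmod_triangle|].
        eapply Rle_trans; [apply Rplus_le_compat_r, Cmod_triangle|].
        rewrite !Cmod_mult, Ht. unfold k.
        pose proof (Cmod_ge_0 b). pose proof (Cmod_ge_0 c).
        assert (s * s <= 1) by nra.
        assert (Cmod b * s <= Cmod b * 1) by (apply Rmult_le_compat_l; lra).
        assert (Cmod c * (s * s) <= Cmod c * 1) by (apply Rmult_le_compat_l; lra).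
        lra. }
      assert (Cmod (a + b * t + c * (t * t))%C * Cmod (h (z0 + t) - (a + b * t + c * (t * t)))%C
        <= k * (eta * s ^ 2)).
      { apply Rmult_le_compat; try apply Cmod_ge_0; assumption. }
      lra. }
    assert (N1 : Cmod (RtoC s) = s) by (rewrite Cmod_R; apply Rabs_pos_eq; lra).
    pose proof (Low s N1) as L1.
    pose proof (Low (Ci * s)%C) as L2. rewrite Cmod_mult, Cmod_Ci, N1, Rmult_1_l in L2.
    specialize (L2 eq_refl).
    pose proof (Low (- s)%C) as L3. rewrite Cmod_opp, N1 in L3. specialize (L3 eq_refl).
    pose proof (Low (- Ci * s)%C) as L4. rewrite Cmod_mult, Cmod_opp, Cmod_Ci, N1, Rmult_1_l in L4.
    specialize (L4 eq_refl).
    pose proof (four_point_quadratic a b c s) as Q1.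
    pose proof (four_point_quadratic z0 1 0 s) as Q2.
    rewrite Cmod_1, Cmod_0 in Q2.
    replace (z0 + 1 * s + 0 * (s * s))%C with (z0 + s)%C in Q2 by ring.
    replace (z0 + 1 * (Ci * s) + 0 * (Ci * s * (Ci * s)))%C with (z0 + Ci * s)%C in Q2 by ring.
    replace (z0 + 1 * (- s) + 0 * (- s * - s))%C with (z0 + - s)%C in Q2 by ring.
    replace (z0 + 1 * (- Ci * s) + 0 * (- Ci * s * (- Ci * s)))%C with (z0 + - Ci * s)%C in Q2 by ring.
    assert (Q2' : e * Cmod (z0 + s)%C ^ 2 + e * Cmod (z0 + Ci * s)%C ^ 2 + e * Cmod (z0 + - s)%C ^ 2
       + e * Cmod (z0 + - Ci * s)%C ^ 2 = 4 * (e * Cmod z0 ^ 2) + 4 * (e * s ^ 2)).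
    { rewrite <- !Rmult_plus_distr_l, Q2. ring. }
    assert (Eta : 2 * k * (eta * s ^ 2) = e * s ^ 2 / 2) by (unfold eta; field; lra).
    assert (0 < s ^ 2) by (apply pow_lt; exact Hs).
    assert (0 < e * s ^ 2) by (apply Rmult_lt_0_compat; assumption).
    assert (0 <= Cmod b ^ 2 * s ^ 2) by (apply Rmult_le_pos; [apply pow2_ge_0|lra]).
    assert (0 <= Cmod c ^ 2 * s ^ 4).
    { apply Rmult_le_pos; [apply pow2_ge_0|left; apply pow_lt; exact Hs]. }
    lra. }
  pose proof (Hmax z1 Hz1) as H1. unfold F in H1. rewrite Hz0eq in H1.
  pose proof (Hbd z0 Hz0eq) as H2.
  assert (Cmod (h z0) ^ 2 <= M ^ 2) by (apply pow_incr; split; [apply Cmod_ge_0|exact H2]).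
  assert (0 <= e * Cmod z1 ^ 2) by (apply Rmult_le_pos; [lra|apply pow2_ge_0]).
  lra. }
assert (K2 : Cmod (h z1) ^ 2 <= M ^ 2).
{ apply Rnot_lt_le. intros L.
  set (g := Cmod (h z1) ^ 2 - M ^ 2) in *.
  assert (R2 : 0 < rho ^ 2) by (apply pow_lt; exact Hrho).
  assert (He : 0 < g / (2 * rho ^ 2)) by (apply Rdiv_lt_0_compat; unfold g; lra).
  specialize (K _ He).
  replace (g / (2 * rho ^ 2) * rho ^ 2) with (g / 2) in K by (field; lra).
  unfold g in K. lra. }
apply Rnot_lt_le. intros L. pose proof (Cmod_ge_0 (h z1)). nra.
Qed.

(** Schwarz's lemma: apply the maximum principle to g(z)/z, extended by g'(0) at 0, on
    the discs of radius rho < R0.  The third derivative gives the second-order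
    expansion of this quotient at 0. *)
Lemma schwarz (g : C -> C) (R0 : R) :
  0 < R0 -> Csmooth 3 (fun u => Cmod u < R0) g -> g 0 = 0 ->
  (forall u, Cmod u < R0 -> Cmod (g u) <= 1) ->
  forall u, Cmod u < R0 -> Cmod (g u) <= Cmod u / R0.
Proof.
intros HR0 S3 G0 B u Hu.
destruct (Req_dec (Cmod u) 0) as [Zu|Nu].
{ apply Cmod_eq_0 in Zu. rewrite Zu, G0, !Cmod_0. unfold Rdiv. lra. }
assert (Pu : 0 < Cmod u) by (pose proof (Cmod_ge_0 u); lra).
assert (S2 := Csmooth_pred _ _ _ S3).
destruct S3 as [g1 [D1 S2']].
set (h := fun z => if Ceq_dec z 0 then g1 0 else (g z / z)%C).
assert (Hexp : forall z, Cmod z < R0 -> expands_2 h z).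
{ intros z Hz. destruct (Ceq_dec z 0) as [Z|N].
  - subst z.
    destruct (taylor_quotient (fun u => Cmod u < R0) g g1 R0 HR0 (fun t Ht => Ht) G0 D1 S2')
      as [a [b H]].
    exists a, b. intros eps He. destruct (H eps He) as [d [Hd H']]. exists d. split; [exact Hd|].
    intros t Ht. rewrite Cplus_0_l. unfold h.
    destruct (Ceq_dec 0 0) as [_|F]; [|now elim F].
    destruct (Ceq_dec t 0) as [Et|Nt].
    + subst t. replace (g1 0 - (g1 0 + a * 0 + b * (0 * 0)))%C with (RtoC 0) by ring.
      rewrite Cmod_0. simpl. lra.
    + apply H'; assumption.
  - assert (Pz : 0 < Cmod z) by (apply Cmod_gt_0; exact N).
    set (U := fun x : C => Cmod x < R0 /\ x <> 0).
    assert (Sh : Csmooth 2 U (fun x => g x * / x)%C).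
    { apply Csmooth_mult.
      - apply Csmooth_sub with (2 := S2). intros x [Hx _]; exact Hx.
      - apply Csmooth_inv; [intros x [_ Hx]; exact Hx|apply Csmooth_id]. }
    assert (Hd : 0 < Rmin (R0 - Cmod z) (Cmod z)) by (apply Rmin_pos; lra).
    assert (HU : forall t, Cmod t < Rmin (R0 - Cmod z) (Cmod z) -> U (z + t)%C).
    { intros t Ht.
      assert (Cmod t < R0 - Cmod z) by (apply Rlt_le_trans with (1 := Ht); apply Rmin_l).
      assert (Cmod t < Cmod z) by (apply Rlt_le_trans with (1 := Ht); apply Rmin_r).
      split.
      - eapply Rle_lt_trans; [apply Cmod_triangle|lra].
      - intros E. assert (E' : z = (- t)%C) by (rewrite <- (Cplus_0_l (- t)), <- E; ring).
        rewrite E', Cmod_opp in H0. lra. }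
    destruct (taylor_2 U _ z _ Hd HU Sh) as [a [b H]].
    exists a, b. intros eps He. destruct (H eps He) as [d [Hd' H']].
    exists (Rmin d (Rmin (R0 - Cmod z) (Cmod z))). split; [apply Rmin_pos; assumption|].
    intros t Ht.
    assert (t1 : Cmod t < d) by (apply Rlt_le_trans with (1 := Ht); apply Rmin_l).
    assert (t2 : Cmod t < Rmin (R0 - Cmod z) (Cmod z)) by (apply Rlt_le_trans with (1 := Ht); apply Rmin_r).
    specialize (H' t t1). destruct (HU t t2) as [_ Nt].
    unfold h. destruct (Ceq_dec (z + t) 0) as [F|_]; [now elim Nt|].
    destruct (Ceq_dec z 0) as [F|_]; [now elim N|]. exact H'. }
assert (K : forall rho, Cmod u < rho < R0 -> Cmod (g u) * rho <= Cmod u).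
{ intros rho Hrho.
  assert (M : Cmod (h u) <= / rho).
  { apply (maximum_principle h rho (/ rho)); [lra|left; apply Rinv_0_lt_compat; lra| | |lra].
    - intros z Hz. apply Hexp. lra.
    - intros z Hz. unfold h. destruct (Ceq_dec z 0) as [F|N].
      + rewrite F, Cmod_0 in Hz. lra.
      + rewrite Cmod_div, Hz by exact N. unfold Rdiv. rewrite <- (Rmult_1_l (/ rho)) at 2.
        apply Rmult_le_compat_r; [left; apply Rinv_0_lt_compat; lra|]. apply B. lra. }
  unfold h in M. destruct (Ceq_dec u 0) as [F|N].
  - rewrite F, Cmod_0 in Pu. lra.
  - rewrite Cmod_div in M by exact N.
    apply (Rmult_le_compat_r (Cmod u * rho)) in M; [|apply Rmult_le_pos; lra].
    replace (Cmod (g u) / Cmod u * (Cmod u * rho)) with (Cmod (g u) * rho) in M by (field; lra).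
    replace (/ rho * (Cmod u * rho)) with (Cmod u) in M by (field; lra). exact M. }
apply Rle_div_r; [exact HR0|]. apply Rnot_lt_le. intros L.
(* a radius rho below R0 and above both |u| and |u|/|g u| contradicts K *)
assert (Pg : 0 < Cmod (g u)) by (pose proof (Cmod_ge_0 (g u)); nra).
assert (Q : Cmod u / Cmod (g u) < R0) by (apply Rlt_div_l; [exact Pg|lra]).
set (m := Rmax (Cmod u) (Cmod u / Cmod (g u))).
assert (Hm : m < R0) by (apply Rmax_lub_lt; assumption).
pose proof (Rmax_l (Cmod u) (Cmod u / Cmod (g u))) as M1. fold m in M1.
pose proof (Rmax_r (Cmod u) (Cmod u / Cmod (g u))) as M2. fold m in M2.
assert (H := K ((m + R0) / 2)). assert (C1 : Cmod u < (m + R0) / 2 < R0) by lra.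
specialize (H C1).
assert (C2 : Cmod u / Cmod (g u) < (m + R0) / 2) by lra.
apply (Rmult_lt_compat_r (Cmod (g u))) in C2; [|exact Pg].
replace (Cmod u / Cmod (g u) * Cmod (g u)) with (Cmod u) in C2 by (field; lra). lra.
Qed.

(** * Exponential, logarithm, square root and arctangent *)

Lemma Cexp_plus (a b : C) : Cexp (a + b) = (Cexp a * Cexp b)%C.
Proof.
destruct a as [a1 a2], b as [b1 b2]. unfold Cexp, Cmult, Cplus, Re, Im; simpl.
rewrite exp_plus, cos_plus, sin_plus. f_equal; ring.
Qed.

Lemma Cexp_0 : Cexp 0 = 1.
Proof.
unfold Cexp, RtoC, Re, Im; simpl. rewrite exp_0, cos_0, sin_0. f_equal; ring.
Qed.

Lemma Cmod_Cexp (z : C) : Cmod (Cexp z) = exp (Re z).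
Proof.
unfold Cmod, Cexp, Re, Im; simpl.
replace (exp (fst z) * cos (snd z) * (exp (fst z) * cos (snd z) * 1) +
  exp (fst z) * sin (snd z) * (exp (fst z) * sin (snd z) * 1))
  with (exp (fst z) * exp (fst z)).
2:{ pose proof (sin2_cos2 (snd z)) as H. unfold Rsqr in H.
    transitivity (exp (fst z) * exp (fst z) * (sin (snd z) * sin (snd z) + cos (snd z) * cos (snd z)));
      [rewrite H|]; ring. }
apply sqrt_square. left; apply exp_pos.
Qed.

Lemma Cexp_neq_0 (z : C) : Cexp z <> 0.
Proof. apply Cmod_gt_0. rewrite Cmod_Cexp. apply exp_pos. Qed.

Lemma Cexp_real (x : R) : Cexp x = exp x.
Proof.
unfold Cexp, RtoC, Re, Im; simpl. rewrite cos_0, sin_0. f_equal; ring.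
Qed.

Lemma lt_Rmin (x a b : R) : x < Rmin a b -> x < a /\ x < b.
Proof.
intros H. split; apply Rlt_le_trans with (1 := H); [apply Rmin_l|apply Rmin_r].
Qed.

Lemma derivable_increment (f : R -> R) (x l : R) :
  derivable_pt_lim f x l -> forall eps, 0 < eps -> exists d, 0 < d /\
    forall h, Rabs h < d -> Rabs (f (x + h) - f x - l * h) <= eps * Rabs h.
Proof.
intros H eps He. destruct (H eps He) as [d Hd]. exists d. split; [apply cond_pos|].
intros h Hh. destruct (Req_dec h 0) as [Z|N].
- subst h. rewrite Rplus_0_r, Rmult_0_r. replace (f x - f x - 0) with 0 by ring.
  rewrite Rabs_R0. lra.
- specialize (Hd h N Hh).
  replace (f (x + h) - f x - l * h) with (((f (x + h) - f x) / h - l) * h) by (field; exact N).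
  rewrite Rabs_mult. apply Rmult_le_compat_r; [apply Rabs_pos|lra].
Qed.

Lemma Cmod_le_components (z : C) : Cmod z <= Rabs (Re z) + Rabs (Im z).
Proof.
replace z with (Re z + Ci * Im z)%C at 1.
2:{ destruct z; unfold Ci, Cplus, Cmult, Re, Im, RtoC; simpl. f_equal; ring. }
eapply Rle_trans; [apply Cmod_triangle|].
rewrite Cmod_mult, Cmod_Ci, !Cmod_R. lra.
Qed.

Lemma Cderiv_Cexp_0 : Cderiv Cexp 0 1.
Proof.
intros eps He.
destruct (derivable_increment exp 0 1) with (eps := Rmin 1 (eps / 8)) as [d1 [Hd1 H1]].
{ pose proof (derivable_pt_lim_exp 0) as H; rewrite exp_0 in H; exact H. }
{ apply Rmin_pos; lra. }
destruct (derivable_increment cos 0 0) with (eps := eps / 8) as [d2 [Hd2 H2]]; [|lra|].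
{ pose proof (derivable_pt_lim_cos 0) as H; rewrite sin_0, Ropp_0 in H; exact H. }
destruct (derivable_increment sin 0 1) with (eps := Rmin 1 (eps / 8)) as [d3 [Hd3 H3]].
{ pose proof (derivable_pt_lim_sin 0) as H; rewrite cos_0 in H; exact H. }
{ apply Rmin_pos; lra. }
exists (Rmin (Rmin d1 (Rmin d2 d3)) (Rmin 1 (eps / 8))). split.
{ repeat apply Rmin_pos; lra. }
intros h Hh.
apply lt_Rmin in Hh; destruct Hh as [Hh Hh3]. apply lt_Rmin in Hh; destruct Hh as [h1 Hh].
apply lt_Rmin in Hh; destruct Hh as [h2 h3]. apply lt_Rmin in Hh3; destruct Hh3 as [h4 h5].
rewrite Cplus_0_l, Cexp_0, Cmult_1_l.
pose proof (re_le_Cmod h) as Ra. pose proof (im_le_Cmod h) as Rb.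
set (a := Re h) in *. set (b := Im h) in *.
pose proof (Rabs_pos a) as Pa. pose proof (Rabs_pos b) as Pb.
assert (E1 := H1 a). assert (E2 := H2 b). assert (E3 := H3 b).
rewrite Rplus_0_l, exp_0 in E1. rewrite Rplus_0_l, cos_0 in E2. rewrite Rplus_0_l, sin_0 in E3.
rewrite Rmult_1_l in E1. rewrite Rmult_0_l, Rminus_0_r in E2. rewrite Rmult_1_l, Rminus_0_r in E3.
specialize (E1 ltac:(lra)). specialize (E2 ltac:(lra)). specialize (E3 ltac:(lra)).
pose proof (Rmin_l 1 (eps / 8)) as L1. pose proof (Rmin_r 1 (eps / 8)) as L2.
set (m := Rmin 1 (eps / 8)) in *.
set (u := exp a - 1 - a) in *. set (v := cos b - 1) in *. set (w := sin b - b) in *.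
assert (Hu : Rabs u <= eps / 8 * Rabs a).
{ eapply Rle_trans; [exact E1|]. apply Rmult_le_compat_r; lra. }
assert (Hu1 : Rabs u <= Rabs a).
{ eapply Rle_trans; [exact E1|]. rewrite <- (Rmult_1_l (Rabs a)) at 2. apply Rmult_le_compat_r; lra. }
assert (Hw : Rabs w <= eps / 8 * Rabs b).
{ eapply Rle_trans; [exact E3|]. apply Rmult_le_compat_r; lra. }
assert (Hw1 : Rabs w <= Rabs b).
{ eapply Rle_trans; [exact E3|]. rewrite <- (Rmult_1_l (Rabs b)) at 2. apply Rmult_le_compat_r; lra. }
eapply Rle_trans; [apply Cmod_le_components|].
replace (Re (Cexp h - 1 - h)%C) with (u * cos b + (1 + a) * v).
2:{ unfold u, v, a, b. destruct h; unfold Cexp, Re, Im; simpl. ring. }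
replace (Im (Cexp h - 1 - h)%C) with ((u + a) * sin b + w).
2:{ unfold u, w, a, b. destruct h; unfold Cexp, Re, Im; simpl. ring. }
assert (Cb : Rabs (cos b) <= 1) by (apply Rabs_le, COS_bound).
assert (A1 : Rabs (u * cos b) <= eps / 8 * Rabs a).
{ rewrite Rabs_mult. rewrite <- (Rmult_1_r (eps / 8 * Rabs a)).
  apply Rmult_le_compat; try apply Rabs_pos; assumption. }
assert (A2 : Rabs ((1 + a) * v) <= 2 * (eps / 8 * Rabs b)).
{ rewrite Rabs_mult. apply Rmult_le_compat; try apply Rabs_pos; [|exact E2].
  eapply Rle_trans; [apply Rabs_triang|]. rewrite Rabs_R1. lra. }
assert (A3 : Rabs ((u + a) * sin b) <= eps / 4 * (2 * Rabs b)).
{ rewrite Rabs_mult. apply Rmult_le_compat; try apply Rabs_pos.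
  - eapply Rle_trans; [apply Rabs_triang|]. lra.
  - replace (sin b) with (w + b) by (unfold w; ring).
    eapply Rle_trans; [apply Rabs_triang|]. lra. }
eapply Rle_trans; [apply Rplus_le_compat; apply Rabs_triang|].
assert (eps * Rabs a <= eps * Cmod h) by (apply Rmult_le_compat_l; lra).
assert (eps * Rabs b <= eps * Cmod h) by (apply Rmult_le_compat_l; lra).
assert (0 <= eps * Rabs a) by (apply Rmult_le_pos; lra).
lra.
Qed.

Lemma Cderiv_Cexp (z : C) : Cderiv Cexp z (Cexp z).
Proof.
apply Cderiv_ext with (fun x => Cexp z * Cexp (x - z))%C.
{ intros x. rewrite <- Cexp_plus. f_equal. ring. }
assert (K : Cderiv (fun x => Cexp z * Cexp (x - z))%C z (Cexp z * (1 * (1 - 0)))%C).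
2:{ replace (Cexp z * (1 * (1 - 0)))%C with (Cexp z) in K by ring. exact K. }
apply Cderiv_scal. apply (Cderiv_comp Cexp (fun x => x - z)%C).
- replace (z - z)%C with (RtoC 0) by ring. apply Cderiv_Cexp_0.
- apply Cderiv_minus; [apply Cderiv_id|apply Cderiv_const].
Qed.

(** ** Principal argument and logarithm *)

Lemma Re_Cmod_bound (z : C) : z <> 0 -> -1 <= Re z / Cmod z <= 1.
Proof.
intros N. assert (P : 0 < Cmod z) by (apply Cmod_gt_0; exact N).
pose proof (re_le_Cmod z) as H. apply Rabs_le_between in H.
split.
- apply Rle_div_r; lra.
- apply Rle_div_l; lra.
Qed.

Lemma cos_Carg (z : C) : z <> 0 -> cos (Carg z) = Re z / Cmod z.
Proof.
intros N. unfold Carg. destruct (Rle_dec 0 (Im z)).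
- apply cos_acos, Re_Cmod_bound, N.
- rewrite cos_neg. apply cos_acos, Re_Cmod_bound, N.
Qed.

Lemma sin_Carg (z : C) : z <> 0 -> sin (Carg z) = Im z / Cmod z.
Proof.
intros N. assert (P : 0 < Cmod z) by (apply Cmod_gt_0; exact N).
assert (E : sin (acos (Re z / Cmod z)) = Rabs (Im z) / Cmod z).
{ rewrite sin_acos by (apply Re_Cmod_bound, N).
  rewrite <- (Rabs_pos_eq (Cmod z)) at 2 by lra. rewrite <- Rabs_div by lra.
  rewrite <- sqrt_Rsqr_abs. f_equal. unfold Rsqr.
  replace (1 - Re z / Cmod z * (Re z / Cmod z)) with ((Cmod z ^ 2 - Re z ^ 2) / Cmod z ^ 2) by (field; lra).
  rewrite Cmod2_alt at 1. field. lra. }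
unfold Carg. destruct (Rle_dec 0 (Im z)) as [H|H].
- rewrite E, Rabs_pos_eq by exact H. reflexivity.
- rewrite sin_neg, E, Rabs_left by lra. field. lra.
Qed.

Lemma Cexp_Clog (z : C) : z <> 0 -> Cexp (Clog z) = z.
Proof.
intros N. assert (P : 0 < Cmod z) by (apply Cmod_gt_0; exact N).
unfold Cexp, Clog, Re at 1 2, Im; simpl.
rewrite exp_ln, cos_Carg, sin_Carg by assumption.
destruct z as [x y]; unfold Re, Im; simpl. f_equal; field; lra.
Qed.

(** On the open strip of height 2 PI the logarithm inverts the exponential. *)
Lemma Clog_Cexp (w : C) : - PI < Im w < PI -> Clog (Cexp w) = w.
Proof.
intros H. unfold Clog. rewrite Cmod_Cexp, ln_exp.
replace w with ((Re w, Im w) : C) at 3 by (destruct w; reflexivity). f_equal.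
assert (E : Re (Cexp w) / Cmod (Cexp w) = cos (Im w)).
{ rewrite Cmod_Cexp. unfold Cexp; unfold Re at 1; simpl. field. apply Rgt_not_eq, exp_pos. }
unfold Carg. rewrite E.
pose proof (exp_pos (Re w)) as Pe.
change (Im (Cexp w)) with (exp (Re w) * sin (Im w)).
destruct (Rle_dec 0 (exp (Re w) * sin (Im w))) as [S|S].
- apply acos_cos. split; [|lra]. apply Rnot_lt_le. intros L.
  assert (sin (Im w) < 0) by (apply sin_lt_0_var; lra). nra.
- rewrite <- cos_neg, acos_cos; [ring|]. split; [|lra].
  apply Rnot_lt_le. intros L.
  assert (0 <= sin (Im w)) by (apply sin_ge_0; lra). nra.
Qed.

Lemma Re_pos_neq_0 (z : C) : 0 < Re z -> z <> 0.
Proof. intros H E. rewrite E in H. unfold Re in H; simpl in H. lra. Qed.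

Lemma Carg_Re_pos (z : C) : 0 < Re z -> - (PI / 2) < Carg z < PI / 2.
Proof.
intros H. pose proof (Re_pos_neq_0 z H) as N.
assert (P : 0 < Cmod z) by (apply Cmod_gt_0; exact N).
assert (Q : 0 < Re z / Cmod z) by (apply Rdiv_lt_0_compat; assumption).
pose proof (Re_Cmod_bound z N) as B.
assert (A : 0 <= acos (Re z / Cmod z) < PI / 2).
{ split; [apply acos_bound|]. apply Rnot_le_lt. intros L.
  pose proof (acos_bound (Re z / Cmod z)) as A.
  assert (cos (acos (Re z / Cmod z)) <= 0).
  { apply cos_le_0; lra. }
  rewrite cos_acos in H0; lra. }
unfold Carg. destruct (Rle_dec 0 (Im z)); lra.
Qed.

Lemma Carg_atan (z : C) : 0 < Re z -> Carg z = atan (Im z / Re z).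
Proof.
intros H. pose proof (Re_pos_neq_0 z H) as N.
assert (P : 0 < Cmod z) by (apply Cmod_gt_0; exact N).
rewrite <- (atan_tan (Carg z)) by (pose proof (Carg_Re_pos z H); lra).
f_equal. unfold tan. rewrite cos_Carg, sin_Carg by exact N. field. lra.
Qed.

Lemma continuous_Ccont_pair (F G : R * R -> R) (z : C) :
  continuous F z -> continuous G z -> Ccont (fun x : C => (F x, G x) : C) z.
Proof.
intros HF HG eps He.
assert (He2 : 0 < eps / 2) by lra.
destruct (proj1 (filterlim_locally _ _) HF (mkposreal _ He2)) as [d1 H1].
destruct (proj1 (filterlim_locally _ _) HG (mkposreal _ He2)) as [d2 H2].
exists (Rmin d1 d2). split; [apply Rmin_pos; apply cond_pos|].
intros h Hh. apply lt_Rmin in Hh; destruct Hh as [h1 h2].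
assert (B : forall d, Cmod h < d -> ball (M := prod_UniformSpace R_UniformSpace R_UniformSpace) z d (z + h)%C).
{ intros d Hd. pose proof (re_le_Cmod h). pose proof (im_le_Cmod h).
  split; simpl.
  - change (Rabs (fst z + fst h - fst z) < d). replace (fst z + fst h - fst z) with (Re h) by (unfold Re; ring). lra.
  - change (Rabs (snd z + snd h - snd z) < d). replace (snd z + snd h - snd z) with (Im h) by (unfold Im; ring). lra. }
specialize (H1 _ (B _ h1)). specialize (H2 _ (B _ h2)).
change (Rabs (F (z + h)%C - F z) < eps / 2) in H1.
change (Rabs (G (z + h)%C - G z) < eps / 2) in H2.
apply Cmod_lt_components; assumption.
Qed.

Lemma half_plane_open (z : C) : 0 < Re z -> forall h, Cmod h < Re z -> 0 < Re (z + h)%C.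
Proof.
intros H h Hh. pose proof (re_le_Cmod h) as B. apply Rabs_le_between in B.
unfold Re, Cplus in *; simpl in *. lra.
Qed.

(** On the right half-plane the argument is atan (y/x), hence continuous. *)
Lemma Ccont_Clog (z : C) : 0 < Re z -> Ccont Clog z.
Proof.
intros H.
assert (K : Ccont (fun x : C => (ln (sqrt (fst x * fst x + snd x * snd x)), atan (snd x / fst x)) : C) z).
{ destruct z as [x y]. unfold Re in H; simpl in H.
  assert (C1 : continuous (fun p : R * R => fst p) (x, y)) by apply continuous_fst.
  assert (C2 : continuous (fun p : R * R => snd p) (x, y)) by apply continuous_snd.
  assert (Q : 0 < x * x + y * y) by nra.
  apply continuous_Ccont_pair.
  - apply (continuous_comp (fun p : R * R => sqrt (fst p * fst p + snd p * snd p)) ln).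
    + apply continuous_comp with (g := sqrt).
      * apply (continuous_plus (V := R_NormedModule)); apply (continuous_mult (K := R_AbsRing)); assumption.
      * simpl. apply continuity_pt_filterlim, continuity_pt_sqrt. lra.
    + simpl. apply continuity_pt_filterlim, derivable_continuous_pt. exists (/ sqrt (x * x + y * y)).
      apply derivable_pt_lim_ln. apply sqrt_lt_R0. exact Q.
  - apply continuous_comp with (g := atan).
    + apply (continuous_mult (K := R_AbsRing)); [exact C2|].
      apply (continuous_comp (fun p : R * R => fst p) Rinv); [exact C1|].
      simpl. apply continuous_Rinv. lra.
    + apply continuity_pt_filterlim. apply derivable_continuous_pt, derivable_pt_atan. }
assert (E : forall x, 0 < Re x -> Clog x = (ln (sqrt (fst x * fst x + snd x * snd x)), atan (snd x / fst x))).
{ intros x Hx. unfold Clog. rewrite Carg_atan by exact Hx. f_equal. f_equal. unfold Cmod. f_equal. ring. }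
intros eps He. destruct (K eps He) as [d [Hd H']].
exists (Rmin d (Re z)). split; [apply Rmin_pos; assumption|].
intros h Hh. apply lt_Rmin in Hh; destruct Hh as [h1 h2].
rewrite !E; [apply H'; exact h1|exact H|]. apply half_plane_open; assumption.
Qed.

(** A continuous local right inverse of a function with nonzero derivative is
    differentiable. *)
Lemma Cderiv_right_inverse (E L : C -> C) (z e : C) (d0 : R) :
  0 < d0 -> (forall h, Cmod h < d0 -> E (L (z + h)%C) = (z + h)%C) ->
  Ccont L z -> e <> 0 -> Cderiv E (L z) e -> Cderiv L z (/ e)%C.
Proof.
intros Hd0 Inv HL Ne HE eps Heps.
assert (Pe : 0 < Cmod e) by (apply Cmod_gt_0; exact Ne).
set (m := Cmod e) in *.
set (eta := Rmin (m / 2) (eps * m * m / 2)).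
assert (Heta : 0 < eta).
{ apply Rmin_pos; [lra|]. assert (0 < eps * m * m) by (repeat apply Rmult_lt_0_compat; lra). lra. }
destruct (HE eta Heta) as [d1 [Hd1 H1]].
destruct (HL d1 Hd1) as [d2 [Hd2 H2]].
exists (Rmin d0 d2). split; [apply Rmin_pos; assumption|].
intros h Hh. apply lt_Rmin in Hh; destruct Hh as [h0 h2].
specialize (H2 h h2). set (k := (L (z + h) - L z)%C) in *.
specialize (H1 k H2).
assert (Ek : E (L z + k)%C = (z + h)%C).
{ unfold k. replace (L z + (L (z + h) - L z))%C with (L (z + h)%C) by ring. apply Inv; exact h0. }
assert (Ez : E (L z) = z).
{ specialize (Inv 0). rewrite Cplus_0_r in Inv. apply Inv. rewrite Cmod_0; exact Hd0. }
rewrite Ek, Ez in H1. replace (z + h - z - e * k)%C with (h - e * k)%C in H1 by ring.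
replace (k - / e * h)%C with (- (h - e * k) / e)%C by (field; exact Ne).
rewrite Cmod_div, Cmod_opp by exact Ne. fold m.
pose proof (Rmin_l (m / 2) (eps * m * m / 2)) as M1. fold eta in M1.
pose proof (Rmin_r (m / 2) (eps * m * m / 2)) as M2. fold eta in M2.
assert (Pk : 0 <= Cmod k) by apply Cmod_ge_0.
assert (Hk : Cmod k <= 2 * Cmod h / m).
{ apply Rle_div_r; [exact Pe|].
  assert (m * Cmod k <= Cmod h + Cmod (h - e * k)%C).
  { unfold m. rewrite <- Cmod_mult. replace (e * k)%C with (h + - (h - e * k))%C at 1 by ring.
    rewrite <- (Cmod_opp (h - e * k)%C). apply Cmod_triangle. }
  assert (eta * Cmod k <= m / 2 * Cmod k) by (apply Rmult_le_compat_r; assumption).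
  lra. }
apply Rle_div_l; [exact Pe|]. eapply Rle_trans; [exact H1|].
apply Rle_trans with (eps * m * m / 2 * (2 * Cmod h / m)).
- apply Rmult_le_compat; lra.
- right. field. lra.
Qed.

Lemma Cderiv_Clog (z : C) : 0 < Re z -> Cderiv Clog z (/ z)%C.
Proof.
intros H. apply Cderiv_right_inverse with Cexp (Re z).
- exact H.
- intros h Hh. apply Cexp_Clog, Re_pos_neq_0, half_plane_open; assumption.
- apply Ccont_Clog; exact H.
- apply Re_pos_neq_0; exact H.
- pose proof (Cderiv_Cexp (Clog z)) as D. rewrite Cexp_Clog in D by (apply Re_pos_neq_0; exact H).
  exact D.
Qed.

(** ** Principal square root *)

Lemma Csqrt_Re_pos (z : C) : 0 < Re z -> Csqrt z = Cexp (Clog z / 2)%C.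
Proof.
intros H. unfold Csqrt. destruct (Ceq_dec z 0) as [E|N]; [|reflexivity].
now apply Re_pos_neq_0 in H.
Qed.

Lemma Csqrt_sqr (z : C) : 0 < Re z -> (Csqrt z * Csqrt z)%C = z.
Proof.
intros H. rewrite Csqrt_Re_pos, <- Cexp_plus by exact H.
replace (Clog z / 2 + Clog z / 2)%C with (Clog z) by field.
apply Cexp_Clog, Re_pos_neq_0, H.
Qed.

Lemma Clog_half (z : C) : (Clog z / 2)%C = (ln (Cmod z) / 2, Carg z / 2).
Proof.
replace (Clog z / 2)%C with ((/ 2)%R * Clog z)%C.
2:{ rewrite RtoC_inv by lra. field. }
unfold Clog, Cmult, RtoC; simpl. f_equal; field.
Qed.

Lemma Re_Csqrt_pos (z : C) : 0 < Re z -> 0 < Re (Csqrt z).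
Proof.
intros H. rewrite Csqrt_Re_pos, Clog_half by exact H.
unfold Cexp, Re, Im; simpl. apply Rmult_lt_0_compat; [apply exp_pos|].
pose proof (Carg_Re_pos z H). apply cos_gt_0; lra.
Qed.

Lemma Cderiv_Csqrt (z : C) : 0 < Re z -> Cderiv Csqrt z (/ (2 * z) * Csqrt z)%C.
Proof.
intros H. assert (N2 : RtoC 2 <> 0) by (apply RtoC_neq_0; lra).
apply Cderiv_ext_loc with (fun x => Cexp (/ 2 * Clog x)%C) (Re z); [exact H| |].
- intros h Hh. rewrite Csqrt_Re_pos by (apply half_plane_open; assumption).
  f_equal. field.
- rewrite Csqrt_Re_pos by exact H.
  replace (/ (2 * z) * Cexp (Clog z / 2))%C with (Cexp (/ 2 * Clog z) * (/ 2 * / z))%C.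
  2:{ replace (/ 2 * Clog z)%C with (Clog z / 2)%C by field.
      field; repeat split; try (apply Re_pos_neq_0; exact H). }
  apply (Cderiv_comp Cexp (fun x => / 2 * Clog x)%C); [apply Cderiv_Cexp|].
  apply Cderiv_scal, Cderiv_Clog, H.
Qed.

Lemma Csqrt_1 : Csqrt 1 = 1.
Proof.
assert (P : 0 < Re 1) by (unfold Re; simpl; lra).
rewrite Csqrt_Re_pos by exact P.
assert (E : Clog 1 = 0).
{ rewrite <- Cexp_0. apply Clog_Cexp. unfold Im; simpl. pose proof PI_RGT_0. lra. }
rewrite E. replace (0 / 2)%C with (RtoC 0) by field. apply Cexp_0.
Qed.

(** ** Arctangent: the disc corresponds to the strip |Re| < PI / 4 *)

Lemma disc_half_planes (w : C) : unit_disc w ->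
  0 < Re (1 + Ci * w)%C /\ 0 < Re (1 - Ci * w)%C.
Proof.
intros H. unfold unit_disc in H. pose proof (im_le_Cmod w) as B. apply Rabs_le_between in B.
destruct w; unfold Re, Im, Ci in *; simpl in *. lra.
Qed.

Lemma ex_Cderiv_Catan (w : C) : unit_disc w -> exists l, Cderiv Catan w l.
Proof.
intros H. destruct (disc_half_planes w H) as [A B]. eexists.
apply Cderiv_ext with (fun z => / (2 * Ci) * (Clog (1 + Ci * z) - Clog (1 - Ci * z)))%C.
{ intros z. unfold Catan, Cdiv. ring. }
apply Cderiv_scal, Cderiv_minus.
- apply (Cderiv_comp Clog (fun z => 1 + Ci * z)%C); [apply Cderiv_Clog, A|].
  apply Cderiv_plus; [apply Cderiv_const|apply Cderiv_scal, Cderiv_id].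
- apply (Cderiv_comp Clog (fun z => 1 - Ci * z)%C); [apply Cderiv_Clog, B|].
  apply Cderiv_minus; [apply Cderiv_const|apply Cderiv_scal, Cderiv_id].
Qed.

Lemma Re_Catan (w : C) : Re (Catan w) = (Carg (1 + Ci * w) - Carg (1 - Ci * w)) / 2.
Proof.
unfold Catan.
replace ((Clog (1 + Ci * w) - Clog (1 - Ci * w)) / (2 * Ci))%C
  with ((/ 2)%R * (- Ci * (Clog (1 + Ci * w) - Clog (1 - Ci * w))))%C.
2:{ rewrite RtoC_inv by lra.
    assert (Ic : (/ Ci)%C = (- Ci)%C).
    { apply (f_equal (fun x => x)).
      assert (I2 : (Ci * - Ci)%C = 1) by (unfold Ci, Cmult, Copp, RtoC; simpl; f_equal; ring).
      replace (/ Ci)%C with (/ Ci * (Ci * - Ci))%C by (rewrite I2; ring).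
      field. apply Ci_nz. }
    rewrite <- Ic. field; repeat split; try apply Ci_nz. }
unfold Clog, Ci, Cmult, Cminus, Cplus, Copp, RtoC, Re; simpl. field.
Qed.

(** The arguments a, b of 1 + iw and 1 - iw satisfy |a - b| < PI, and cos (a - b) has
    the sign of 1 - |w|^2. *)
Lemma Re_Catan_bound (w : C) : unit_disc w -> Rabs (Re (Catan w)) < PI / 4.
Proof.
intros H. destruct (disc_half_planes w H) as [A B]. rewrite Re_Catan.
pose proof (Carg_Re_pos _ A) as A1. pose proof (Carg_Re_pos _ B) as B1.
pose proof (Re_pos_neq_0 _ A) as A2. pose proof (Re_pos_neq_0 _ B) as B2.
assert (K : 0 < cos (Carg (1 + Ci * w) - Carg (1 - Ci * w))).
{ rewrite cos_minus, !cos_Carg, !sin_Carg by assumption.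
  assert (A3 : 0 < Cmod (1 + Ci * w)%C) by (apply Cmod_gt_0; exact A2).
  assert (B3 : 0 < Cmod (1 - Ci * w)%C) by (apply Cmod_gt_0; exact B2).
  set (a := Cmod (1 + Ci * w)%C) in *. set (b := Cmod (1 - Ci * w)%C) in *.
  replace (Re (1 + Ci * w)%C / a * (Re (1 - Ci * w)%C / b) + Im (1 + Ci * w)%C / a * (Im (1 - Ci * w)%C / b))
    with ((1 - Cmod w ^ 2) / (a * b)).
  2:{ rewrite Cmod2_alt. destruct w; unfold Re, Im, Ci; simpl. field. lra. }
  apply Rdiv_lt_0_compat; [|apply Rmult_lt_0_compat; assumption].
  unfold unit_disc in H. pose proof (Cmod_ge_0 w). nra. }
set (t := Carg (1 + Ci * w) - Carg (1 - Ci * w)) in *.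
assert (- (PI / 2) < t < PI / 2).
{ assert (- PI < t < PI) by (unfold t; lra).
  split; apply Rnot_le_lt; intros L.
  - assert (cos (- t) <= 0) by (apply cos_le_0; lra). rewrite cos_neg in H1. lra.
  - assert (cos t <= 0) by (apply cos_le_0; lra). lra. }
apply Rabs_def1; lra.
Qed.

(** The tangent, written with e^(2iW) so that it is a quotient of exponentials. *)
Definition Ctan (W : C) : C :=
  (- Ci * ((Cexp (2 * Ci * W) - 1) * / (Cexp (2 * Ci * W) + 1)))%C.

Lemma Re_Cexp_strip (W : C) : Rabs (Re W) < PI / 4 -> 0 < Re (Cexp (2 * Ci * W)%C).
Proof.
intros H. apply Rabs_def2 in H.
change (0 < exp (Re (2 * Ci * W)%C) * cos (Im (2 * Ci * W)%C)).
apply Rmult_lt_0_compat; [apply exp_pos|].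
replace (Im (2 * Ci * W)%C) with (2 * Re W).
2:{ destruct W; unfold Im, Re, Ci; simpl. ring. }
apply cos_gt_0; lra.
Qed.

Lemma Ctan_den (W : C) : Rabs (Re W) < PI / 4 -> (Cexp (2 * Ci * W) + 1)%C <> 0.
Proof.
intros H. apply Re_Cexp_strip in H. apply Re_pos_neq_0.
unfold Re, Cplus in *; simpl in *. lra.
Qed.

Lemma Ctan_disc (W : C) : Rabs (Re W) < PI / 4 -> unit_disc (Ctan W).
Proof.
intros H. pose proof (Ctan_den W H) as N. pose proof (Re_Cexp_strip W H) as P.
unfold unit_disc, Ctan. set (E := Cexp (2 * Ci * W)%C) in *.
rewrite Cmod_mult, Cmod_opp, Cmod_Ci, Rmult_1_l, Cmod_mult, Cmod_inv by exact N.
assert (Q : 0 < Cmod (E + 1)%C) by (apply Cmod_gt_0; exact N).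
apply Rlt_div_l; [exact Q|]. rewrite Rmult_1_l.
assert (S : Cmod (E - 1)%C ^ 2 < Cmod (E + 1)%C ^ 2).
{ rewrite !Cmod2_alt. destruct E; unfold Re, Im in *; simpl in *. nra. }
apply Rnot_le_lt. intros L. pose proof (Cmod_ge_0 (E - 1)%C). nra.
Qed.

(** With E = e^(2iW), 1 + i tan W = E (1 - i tan W) and both numbers lie in the right
    half-plane, so no branch jump occurs. *)
Lemma Catan_Ctan (W : C) : Rabs (Re W) < PI / 4 -> Catan (Ctan W) = W.
Proof.
intros H. pose proof (Ctan_den W H) as N.
destruct (disc_half_planes _ (Ctan_disc W H)) as [A B].
assert (I2 : (Ci * - Ci)%C = 1) by (unfold Ci, Cmult, Copp, RtoC; simpl; f_equal; ring).
assert (EA : (1 + Ci * Ctan W)%C = Cexp (Clog (1 - Ci * Ctan W) + 2 * Ci * W)%C).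
{ rewrite Cexp_plus, Cexp_Clog by (apply Re_pos_neq_0; exact B).
  unfold Ctan. set (E := Cexp (2 * Ci * W)%C) in *.
  replace (Ci * (- Ci * ((E - 1) * / (E + 1))))%C with (Ci * - Ci * ((E - 1) * / (E + 1)))%C by ring.
  rewrite I2. field. exact N. }
unfold Catan. rewrite EA at 1. rewrite Clog_Cexp.
- field; repeat split; try apply Ci_nz.
- pose proof (Carg_Re_pos _ B) as Q. apply Rabs_def2 in H.
  replace (Im (Clog (1 - Ci * Ctan W) + 2 * Ci * W)%C) with (Carg (1 - Ci * Ctan W) + 2 * Re W).
  2:{ set (T := (1 - Ci * Ctan W)%C). destruct W; unfold Clog, Im, Re, Ci; simpl. ring. }
  lra.
Qed.

Lemma Csmooth_Cexp (n : nat) (U : C -> Prop) (f : C -> C) :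
  Csmooth n U f -> Csmooth n U (fun z => Cexp (f z)).
Proof.
revert f; induction n as [|n IH]; intros f; [simpl; auto|].
intros F. pose proof (Csmooth_pred _ _ _ F) as F0. destruct F as [f' [F1 F2]].
exists (fun z => Cexp (f z) * f' z)%C. split.
- intros z Hz. apply (Cderiv_comp Cexp f); [apply Cderiv_Cexp|auto].
- apply Csmooth_mult; [apply IH; exact F0|exact F2].
Qed.

Lemma Csmooth_Ctan (n : nat) (U : C -> Prop) (f : C -> C) :
  (forall z, U z -> Rabs (Re (f z)) < PI / 4) ->
  Csmooth n U f -> Csmooth n U (fun z => Ctan (f z)).
Proof.
intros H S.
assert (E : Csmooth n U (fun z => Cexp (2 * Ci * f z)%C)) by (apply Csmooth_Cexp, Csmooth_scal, S).
unfold Ctan. apply Csmooth_scal, Csmooth_mult.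
- apply Csmooth_minus; [exact E|apply Csmooth_const].
- apply Csmooth_inv; [intros z Hz; apply Ctan_den, H, Hz|].
  apply Csmooth_plus; [exact E|apply Csmooth_const].
Qed.

Lemma Ctan_0 : Ctan 0 = 0.
Proof.
unfold Ctan. replace (2 * Ci * 0)%C with (RtoC 0) by ring. rewrite Cexp_0. ring.
Qed.

(** * The equation u' = q u and the extremal functions *)

(** [ode_seq q n] holds the first [n + 1] coefficients of the power series solution of
    u' = q u, u(0) = 1, where [q] lists the coefficients of the given series; the new
    coefficient u_(m+1) is (sum_(j <= m) q_j u_(m-j)) / (m + 1). *)
Fixpoint ode_seq (q : nat -> C) (n : nat) : nat -> C :=
  match n with
  | O => fun _ => RtoC 1
  | S m => fun k =>
      if Nat.leb k m then ode_seq q m k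
      else (/ INR (S m) * sum_n (G := C_AbelianMonoid) (fun j => q j * ode_seq q m (m - j)%nat) m)%C
  end.

(** The coefficients of that solution. *)
Definition ode_coef (q : nat -> C) (n : nat) : C := ode_seq q n n.

Lemma ode_seq_coef (q : nat -> C) (n k : nat) : (k <= n)%nat -> ode_seq q n k = ode_coef q k.
Proof.
induction n as [|n IH]; intros H.
- assert (k = 0)%nat by lia. subst k. reflexivity.
- destruct (Nat.eq_dec k (S n)) as [E|N]; [subst k; reflexivity|].
  simpl. rewrite (proj2 (Nat.leb_le k n)) by lia. apply IH; lia.
Qed.

Lemma ode_coef_S (q : nat -> C) (m : nat) :
  ode_coef q (S m)
  = (/ INR (S m) * sum_n (G := C_AbelianMonoid) (fun j => q j * ode_coef q (m - j)%nat) m)%C.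
Proof.
unfold ode_coef at 1. cbn [ode_seq]. rewrite (proj2 (Nat.leb_gt (S m) m)) by lia.
f_equal. apply sum_n_ext_loc. intros j Hj. rewrite ode_seq_coef by lia. reflexivity.
Qed.

Lemma Cmod_sum_n (a : nat -> C) (n : nat) :
  Cmod (sum_n (G := C_AbelianMonoid) a n) <= sum_f_R0 (fun k => Cmod (a k)) n.
Proof.
induction n as [|n IH].
- rewrite sum_O. simpl. lra.
- rewrite sum_Sn. simpl sum_f_R0. eapply Rle_trans; [apply Cmod_triangle|]. lra.
Qed.

Lemma sum_weights (m k : nat) : (k <= m)%nat ->
  sum_f_R0 (fun j => 2 * (INR (m - j) + 1)) k = 2 * (INR k + 1) * (INR m + 1) - INR k * (INR k + 1).
Proof.
induction k as [|k IH]; intros H.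
- simpl. rewrite Nat.sub_0_r. ring.
- simpl sum_f_R0. rewrite IH by lia. rewrite minus_INR, S_INR by lia. ring.
Qed.

(** If the coefficients of [q] are bounded by 2, those of [u] are bounded by the
    coefficients n + 1 of the solution for q = 2/(1 - z), i.e. 1/(1 - z)^2. *)
Lemma ode_coef_bound (q : nat -> C) : (forall k, Cmod (q k) <= 2) ->
  forall n, Cmod (ode_coef q n) <= INR n + 1.
Proof.
intros Hq n. induction n as [n IH] using (well_founded_induction Wf_nat.lt_wf).
destruct n as [|m].
- unfold ode_coef; simpl. rewrite Cmod_1. lra.
- rewrite ode_coef_S, Cmod_mult, Cmod_inv.
  2:{ apply RtoC_neq_0, not_0_INR; lia. }
  rewrite Cmod_R, Rabs_pos_eq by apply pos_INR.
  assert (P : 0 < INR (S m)) by (apply lt_0_INR; lia).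
  apply Rmult_le_reg_l with (INR (S m)); [exact P|].
  rewrite <- Rmult_assoc, Rinv_r, Rmult_1_l by lra.
  eapply Rle_trans; [apply Cmod_sum_n|].
  apply Rle_trans with (sum_f_R0 (fun j => 2 * (INR (m - j) + 1)) m).
  + apply sum_Rle. intros j Hj. rewrite Cmod_mult.
    apply Rmult_le_compat; try apply Cmod_ge_0; [apply Hq|]. apply IH. lia.
  + rewrite sum_weights by lia. rewrite S_INR. right. ring.
Qed.

Lemma ode_coef_growth (q : nat -> C) : (forall k, Cmod (q k) <= 2) -> poly_growth (ode_coef q).
Proof.
intros Hq. exists 1%nat, 1. split; [lra|]. intros n. rewrite S_INR.
pose proof (ode_coef_bound q Hq n). lra.
Qed.

Lemma ode_solution (q : nat -> C) (z : C) :
  (forall k, Cmod (q k) <= 2) -> unit_disc z ->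
  Cderiv (CPS (ode_coef q)) z (CPS q z * CPS (ode_coef q) z)%C.
Proof.
intros Hq Hz. pose proof (ode_coef_growth q Hq) as G.
assert (Gq : poly_growth q) by (apply growth_bounded with 2; exact Hq).
rewrite <- (CPS_unique (PSd (ode_coef q)) z (CPS q z * CPS (ode_coef q) z)%C).
- apply CPS_deriv; assumption.
- apply growth_PSd; exact G.
- exact Hz.
- generalize (CPS_mult q (ode_coef q) z Gq G Hz). apply Cseries_ext. intros n.
  unfold PSd. rewrite ode_coef_S. field. apply RtoC_neq_0, not_0_INR; lia.
Qed.

(** The solution has no zero: its product with the solution for - q is 1. *)
Lemma ode_solution_neq_0 (q : nat -> C) (z : C) :
  (forall k, Cmod (q k) <= 2) -> unit_disc z -> CPS (ode_coef q) z <> 0.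
Proof.
intros Hq Hz.
set (p := fun k => (- (1) * q k)%C).
assert (Hp : forall k, Cmod (p k) <= 2).
{ intros k. unfold p. rewrite Cmod_mult, Cmod_m1, Rmult_1_l. apply Hq. }
assert (Gq : poly_growth q) by (apply growth_bounded with 2; exact Hq).
assert (Gp : poly_growth p) by (apply growth_bounded with 2; exact Hp).
assert (Ep : forall x, unit_disc x -> CPS p x = (- CPS q x)%C).
{ intros x Hx. apply CPS_unique; [exact Gp|exact Hx|].
  replace (- CPS q x)%C with (- (1) * CPS q x)%C by ring.
  generalize (Cseries_scal (- (1))%C _ _ (CPS_correct q x Gq Hx)). apply Cseries_ext.
  intros n. unfold p. ring. }
assert (K : (CPS (ode_coef q) z * CPS (ode_coef p) z)%C = (CPS (ode_coef q) 0 * CPS (ode_coef p) 0)%C).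
{ apply (zero_derivative_const (fun x => CPS (ode_coef q) x * CPS (ode_coef p) x)%C); [|exact Hz].
  intros x Hx.
  pose proof (Cderiv_mult _ _ _ _ _ (ode_solution q x Hq Hx) (ode_solution p x Hp Hx)) as D.
  rewrite Ep in D by exact Hx.
  match type of D with Cderiv _ _ ?l => replace l with (RtoC 0) in D by ring end. exact D. }
rewrite !CPS_0 in K by (apply ode_coef_growth; assumption).
unfold ode_coef at 3 4 in K. simpl in K.
intros Z. rewrite Z, Cmult_0_l, Cmult_1_l in K. symmetry in K. now apply C1_nz in K.
Qed.

Lemma Cderiv_ext_disc (f g : C -> C) (z l : C) :
  unit_disc z -> (forall x, unit_disc x -> f x = g x) -> Cderiv f z l -> Cderiv g z l.
Proof.
unfold unit_disc. intros Hz E. apply Cderiv_ext_loc with (1 - Cmod z); [lra|].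
intros h Hh. apply E. eapply Rle_lt_trans; [apply Cmod_triangle|lra].
Qed.

Lemma analytic_Cderiv (f : C -> C) :
  analytic_on_disc f <-> forall z, unit_disc z -> exists l, Cderiv f z l.
Proof. split; intros H z Hz; apply ex_derive_Cderiv, H, Hz. Qed.

(** The extremal function of S*(psi), with z f'/f = psi itself: f = z u, where
    u' = ((psi - 1)/z) u. *)
Lemma extremal_function (psi : C -> C) (b : nat -> C) :
  (forall k, Cmod (b k) <= 2) -> b 0%nat = 1 ->
  (forall z, unit_disc z -> psi z = CPS b z) ->
  exists f, class_S psi f /\ forall z, unit_disc z -> zdlog f z = psi z.
Proof.
intros Hb b0 Hpsi.
assert (Gb : poly_growth b) by (apply growth_bounded with 2; exact Hb).
set (q := fun k => b (S k)).
assert (Hq : forall k, Cmod (q k) <= 2) by (intros; apply Hb).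
assert (Gq : poly_growth q) by (apply growth_bounded with 2; exact Hq).
assert (Psi : forall z, unit_disc z -> psi z = (1 + z * CPS q z)%C).
{ intros z Hz. rewrite (Hpsi z Hz), CPS_tail, b0 by assumption. reflexivity. }
assert (Apsi : forall z, unit_disc z -> exists l, Cderiv psi z l).
{ intros z Hz. exists (CPS (PSd b) z). apply Cderiv_ext_disc with (CPS b); [exact Hz| |].
  - intros x Hx. symmetry. apply Hpsi, Hx.
  - apply CPS_deriv; assumption. }
set (c := ode_coef q). set (u := CPS c).
assert (Gc : poly_growth c) by (apply ode_coef_growth; exact Hq).
set (f := fun z => (z * u z)%C).
assert (Df : forall z, unit_disc z -> Cderiv f z (psi z * u z)%C).
{ intros z Hz. rewrite (Psi z Hz).
  replace ((1 + z * CPS q z) * u z)%C with (1 * u z + z * (CPS q z * u z))%C by ring.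
  apply (Cderiv_mult (fun z => z) u); [apply Cderiv_id|apply ode_solution; assumption]. }
assert (Zf : forall z, unit_disc z -> zdlog f z = psi z).
{ intros z Hz. unfold zdlog. destruct (Ceq_dec z 0) as [E|N].
  - subst z. rewrite (Psi 0 Hz). ring.
  - rewrite (Cderiv_unique_C_derive _ _ _ (Df z Hz)). unfold f. field.
    split; [apply ode_solution_neq_0; assumption|exact N]. }
exists f. split; [|exact Zf].
split; [split|split].
- apply analytic_Cderiv. intros z Hz. eexists. apply Df; exact Hz.
- exists (fun n => match n with O => RtoC 0 | S m => c m end).
  split; [reflexivity|]. split; [reflexivity|].
  intros z Hz. apply is_pseries_Cseries. apply Cseries_pow_shift. apply CPS_correct; assumption.
- intros z Hz N. apply Cmult_neq_0; [exact N|]. apply ode_solution_neq_0; assumption.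
- split; [|split].
  + apply analytic_Cderiv. intros z Hz. destruct (Apsi z Hz) as [l Hl]. exists l.
    apply Cderiv_ext_disc with psi; [exact Hz| |exact Hl]. intros x Hx. symmetry; apply Zf, Hx.
  + apply analytic_Cderiv. exact Apsi.
  + exists (fun z => z). split; [|split; [|split; [|split]]]; auto.
    * apply analytic_Cderiv. intros z _. exists (RtoC 1). apply Cderiv_id.
    * intros; lra.
Qed.

(** * Dilations *)

Lemma unit_disc_scal (r : R) (z : C) : 0 < r <= 1 -> unit_disc z -> unit_disc (r * z)%C.
Proof.
intros Hr Hz. unfold unit_disc in *. eapply Rle_lt_trans; [apply Cmod_scal_le; lra|exact Hz].
Qed.

Lemma Cderiv_dilation (r : R) (f : C -> C) (z l : C) :
  0 < r -> Cderiv f (r * z)%C l -> Cderiv (dilation r f) z l.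
Proof.
intros Hr H. unfold dilation.
replace l with (/ r * (l * (r * 1)))%C by (field; apply RtoC_neq_0; lra).
apply Cderiv_scal. apply (Cderiv_comp f (fun z => r * z)%C); [exact H|].
apply Cderiv_scal, Cderiv_id.
Qed.

Lemma zdlog_dilation (psi f : C -> C) (r : R) (z : C) :
  class_S psi f -> 0 < r <= 1 -> unit_disc z -> zdlog (dilation r f) z = zdlog f (r * z)%C.
Proof.
intros [[A _] [N _]] Hr Hz.
assert (Nr : RtoC r <> 0) by (apply RtoC_neq_0; lra).
pose proof (unit_disc_scal r z Hr Hz) as Hrz.
unfold zdlog. destruct (Ceq_dec z 0) as [E|Nz].
- subst z. destruct (Ceq_dec (r * 0) 0) as [_|F]; [reflexivity|]. elim F. ring.
- destruct (Ceq_dec (r * z) 0) as [E|Nrz].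
  { exfalso. apply Cmult_neq_0 in E; assumption. }
  destruct (proj1 (analytic_Cderiv f) A _ Hrz) as [l Hl].
  rewrite (Cderiv_unique_C_derive _ _ _ Hl).
  rewrite (Cderiv_unique_C_derive _ _ l).
  + unfold dilation. field. split; [apply N; assumption|exact Nr].
  + apply Cderiv_dilation; [lra|exact Hl].
Qed.

Lemma class_A_dilation (f : C -> C) (r : R) :
  0 < r <= 1 -> class_A f -> class_A (dilation r f).
Proof.
intros Hr [A [a [a0 [a1 Ha]]]]. split.
- apply analytic_Cderiv. intros z Hz.
  destruct (proj1 (analytic_Cderiv f) A _ (unit_disc_scal r z Hr Hz)) as [l Hl].
  exists l. apply Cderiv_dilation; [lra|exact Hl].
- exists (fun n => / r * (a n * r ^ n))%C. split; [|split].
  + rewrite a0. ring.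
  + rewrite a1. simpl. field. apply RtoC_neq_0; lra.
  + intros z Hz. apply is_pseries_Cseries.
    pose proof (Ha _ (unit_disc_scal r z Hr Hz)) as H. apply is_pseries_Cseries in H.
    generalize (Cseries_scal (/ r)%C _ _ H). apply Cseries_ext. intros n.
    rewrite Cpow_mult_l. ring.
Qed.

(** * The radius theorem *)

(** Members of S*_tau have z f'/f in the strip |Re w - 1| < PI / 4. *)
Lemma S_tau_strip (f : C -> C) (z : C) :
  S_tau f -> unit_disc z -> Rabs (Re (zdlog f z) - 1) < PI / 4.
Proof.
intros [_ [_ [_ [_ [w [_ [Hw [_ [_ E]]]]]]]]] Hz.
rewrite (E z Hz). replace (Re (1 + Catan (w z))%C - 1) with (Re (Catan (w z))).
- apply Re_Catan_bound, Hw, Hz.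
- unfold Re, Cplus, RtoC; simpl. ring.
Qed.

(** If psi maps the disc of radius R0 into the strip |Re w - 1| < PI / 4, then
    tan (psi - 1) maps it into the unit disc and vanishes at 0; by Schwarz's
    lemma its composition with w(rz) is again bounded by |z|. *)
Lemma dilations_in_S_tau (psi : C -> C) (b : nat -> C) (R0 : R) :
  0 < R0 <= 1 -> poly_growth b -> b 0%nat = 1 ->
  (forall z, unit_disc z -> psi z = CPS b z) ->
  (forall u, Cmod u < R0 -> Rabs (Re (psi u) - 1) < PI / 4) ->
  dilations_in S_tau (class_S psi) R0.
Proof.
intros HR Gb b0 Hpsi Hstrip f Hf r Hr.
assert (Hr1 : 0 < r <= 1) by lra.
pose proof Hf as [Af [Nf [Az [_ [w [Aw [Dw [w0 [Lw Ew]]]]]]]]].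
set (V := fun u => Cmod u < R0).
assert (Vd : forall u, V u -> unit_disc u) by (unfold V, unit_disc; intros; lra).
set (g := fun u => Ctan (CPS b u - 1)%C).
assert (Strip : forall u, V u -> Rabs (Re (CPS b u - 1)%C) < PI / 4).
{ intros u Hu. rewrite <- Hpsi by (apply Vd; exact Hu).
  replace (Re (psi u - 1)%C) with (Re (psi u) - 1); [apply Hstrip; exact Hu|].
  unfold Re, Cminus, Cplus, Copp, RtoC; simpl. ring. }
assert (Sg : Csmooth 3 V g).
{ apply Csmooth_Ctan; [exact Strip|]. apply Csmooth_minus; [|apply Csmooth_const].
  apply Csmooth_sub with unit_disc; [exact Vd|apply Csmooth_CPS; exact Gb]. }
assert (g0 : g 0 = 0).
{ unfold g. rewrite CPS_0, b0 by exact Gb. replace (1 - 1)%C with (RtoC 0) by ring. apply Ctan_0. }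
assert (Gg : forall u, V u -> Cmod (g u) <= Cmod u / R0).
{ apply schwarz; [lra|exact Sg|exact g0|].
  intros u Hu. left. apply Ctan_disc, Strip, Hu. }
assert (Vw : forall z, unit_disc z -> V (w (r * z)%C)).
{ intros z Hz. pose proof (unit_disc_scal r z Hr1 Hz) as Hrz. unfold V.
  eapply Rle_lt_trans; [apply Lw; exact Hrz|].
  rewrite Cmod_mult, Cmod_R, Rabs_pos_eq by lra. unfold unit_disc in Hz.
  pose proof (Cmod_ge_0 z). nra. }
assert (Lg : forall z, unit_disc z -> Cmod (g (w (r * z)%C)) <= Cmod z).
{ intros z Hz. eapply Rle_trans; [apply Gg, Vw, Hz|].
  apply Rle_div_l; [lra|]. eapply Rle_trans; [apply Lw, unit_disc_scal; assumption|].
  rewrite Cmod_mult, Cmod_R, Rabs_pos_eq by lra.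
  pose proof (Cmod_ge_0 z). nra. }
split; [|split].
- apply class_A_dilation; assumption.
- intros z Hz Nz. unfold dilation.
  assert (Nr : RtoC r <> 0) by (apply RtoC_neq_0; lra).
  apply Cmult_neq_0.
  + intros E. apply C1_nz. rewrite <- (Cinv_r r Nr), E. ring.
  + apply Nf; [apply unit_disc_scal; assumption|]. apply Cmult_neq_0; assumption.
- split; [|split].
  + apply analytic_Cderiv. intros z Hz.
    destruct (proj1 (analytic_Cderiv _) Az _ (unit_disc_scal r z Hr1 Hz)) as [l Hl].
    exists (l * (r * 1))%C.
    apply Cderiv_ext_disc with (fun x => zdlog f (r * x)%C); [exact Hz| |].
    * intros x Hx. symmetry. apply (zdlog_dilation psi); assumption.
    * apply (Cderiv_comp (zdlog f) (fun z => r * z)%C); [exact Hl|].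
      apply Cderiv_scal, Cderiv_id.
  + apply analytic_Cderiv. intros z Hz. destruct (ex_Cderiv_Catan z Hz) as [l Hl].
    exists (0 + l)%C. apply Cderiv_plus; [apply Cderiv_const|exact Hl].
  + exists (fun z => g (w (r * z)%C)). split; [|split; [|split; [|split]]].
    * apply analytic_Cderiv. intros z Hz.
      destruct (proj1 (analytic_Cderiv _) Aw _ (unit_disc_scal r z Hr1 Hz)) as [l Hl].
      destruct Sg as [g' [Dg _]].
      exists (g' (w (r * z)%C) * (l * (r * 1)))%C.
      apply (Cderiv_comp g (fun z => w (r * z)%C)); [apply Dg, Vw, Hz|].
      apply (Cderiv_comp w (fun z => r * z)%C); [exact Hl|].
      apply Cderiv_scal, Cderiv_id.
    * intros z Hz. apply Ctan_disc, Strip, Vw, Hz.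
    * rewrite Cmult_0_r, w0. exact g0.
    * exact Lg.
    * intros z Hz. rewrite (zdlog_dilation psi) by assumption.
      pose proof (unit_disc_scal r z Hr1 Hz) as Hrz.
      rewrite (Ew _ Hrz), Hpsi by (apply Dw; exact Hrz).
      unfold g. rewrite Catan_Ctan by (apply Strip, Vw, Hz). ring.
Qed.

(** The criterion behind all five radii: psi maps the open disc of radius R0 into the
    strip |Re w - 1| < PI / 4, and some point of the boundary circle out of it. *)
Lemma tau_radius (psi : C -> C) (b : nat -> C) (R0 : R) (u0 : C) :
  0 < R0 < 1 -> (forall k, Cmod (b k) <= 2) -> b 0%nat = 1 ->
  (forall z, unit_disc z -> psi z = CPS b z) ->
  (forall u, Cmod u < R0 -> Rabs (Re (psi u) - 1) < PI / 4) ->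
  Cmod u0 = R0 -> PI / 4 <= Rabs (Re (psi u0) - 1) ->
  is_radius S_tau (class_S psi) R0 /\ sharp S_tau (class_S psi) R0.
Proof.
intros HR Hb b0 Hpsi Hstrip Hu0 Hout.
assert (Sh : sharp S_tau (class_S psi) R0).
{ intros R1 HR1.
  destruct (extremal_function psi b Hb b0 Hpsi) as [f [Hf Zf]].
  exists f. split; [exact Hf|].
  (* [u0] is the image of a point of the unit disc under the dilation by r > R0 *)
  set (r := (R0 + R1) / 2). assert (Hr : R0 < r < R1) by (unfold r; lra).
  exists r. split; [lra|]. intros HG.
  assert (Nr : RtoC r <> 0) by (apply RtoC_neq_0; lra).
  set (z := (u0 / r)%C).
  assert (Hz : unit_disc z).
  { unfold unit_disc, z. rewrite Cmod_div, Hu0, Cmod_R, Rabs_pos_eq by (exact Nr || lra).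
    apply Rlt_div_l; lra. }
  assert (E : (r * z)%C = u0) by (unfold z; field; exact Nr).
  pose proof (S_tau_strip _ z HG Hz) as H.
  rewrite (zdlog_dilation psi), E in H by (assumption || lra).
  rewrite Zf in H by (unfold unit_disc; lra). lra. }
split; [|exact Sh]. split; [split|].
- lra.
- apply dilations_in_S_tau with b; try assumption; [lra|].
  apply growth_bounded with 2; exact Hb.
- intros R1 HR1 HD. apply Rnot_lt_le. intros L.
  destruct (Sh R1) as [f [Hf [r [Hr HN]]]]; [lra|].
  apply HN. apply HD; assumption.
Qed.

(** * Numerical bounds *)

(** From the Machin-like formula PI/4 = 2 atan (1/3) + atan (1/7). *)
Lemma PI_bounds : 3.14159265 <= PI <= 3.14159266.
Proof.
pose proof (PI_2_3_7_ineq 4) as [L U].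
unfold PI_2_3_7_tg, tg_alt, Ratan_seq in L, U.
cbn [sum_f_R0 Nat.mul Nat.add] in L, U.
rewrite !INR_IZR_INZ in L; rewrite !INR_IZR_INZ in U. cbn [Z.of_nat Pos.of_succ_nat Pos.succ pow] in L, U.
lra.
Qed.

Lemma is_series_exp (x : R) : is_series (fun k => x ^ k / INR (fact k)) (exp x).
Proof.
generalize (is_exp_Reals x). apply is_series_ext. intros n. rewrite pow_n_pow. reflexivity.
Qed.

(** Upper Taylor bound: the tail is dominated by a geometric series. *)
Lemma exp_le_taylor (x : R) (n : nat) : 0 <= x < 1 ->
  exp x <= sum_f_R0 (fun k => x ^ k / INR (fact k)) n + x ^ S n / INR (fact (S n)) / (1 - x).
Proof.
intros Hx.
assert (G : is_series (fun k => x ^ S n / INR (fact (S n)) * x ^ k) (x ^ S n / INR (fact (S n)) / (1 - x))).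
{ apply (is_series_scal (K := R_AbsRing) (V := R_NormedModule) (x ^ S n / INR (fact (S n))) (fun k => x ^ k)).
  apply is_series_geom. rewrite Rabs_pos_eq; lra. }
assert (T : is_series (fun k => x ^ (S n + k) / INR (fact (S n + k)))
  (exp x - sum_f_R0 (fun k => x ^ k / INR (fact k)) n)).
{ apply (is_series_incr_n (K := R_AbsRing) (V := R_NormedModule) (fun k => x ^ k / INR (fact k)) (S n)); [lia|].
  simpl Init.Nat.pred. rewrite sum_n_Reals.
  change plus with Rplus.
  replace (exp x - sum_f_R0 (fun k => x ^ k / INR (fact k)) n + sum_f_R0 (fun k => x ^ k / INR (fact k)) n)
    with (exp x) by ring.
  apply is_series_exp. }
assert (L : exp x - sum_f_R0 (fun k => x ^ k / INR (fact k)) n <= x ^ S n / INR (fact (S n)) / (1 - x)).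
{ rewrite <- (is_series_unique _ _ T), <- (is_series_unique _ _ G).
  apply Series_le; [|eexists; exact G].
  intros k. assert (P : 0 <= x ^ (S n + k)) by (apply pow_le; lra).
  pose proof (INR_fact_lt_0 (S n)) as F1. pose proof (INR_fact_lt_0 (S n + k)) as F2.
  split; [apply Rmult_le_pos; [exact P|left; apply Rinv_0_lt_compat; exact F2]|].
  replace (x ^ S n / INR (fact (S n)) * x ^ k) with (x ^ (S n + k) / INR (fact (S n)))
    by (rewrite pow_add; field; lra).
  apply Rmult_le_compat_l; [exact P|]. apply Rinv_le_contravar; [exact F1|].
  apply le_INR, fact_le. lia. }
lra.
Qed.

(** Turns a Taylor sum into an explicit rational expression, expanding the factorials
    as products of reals rather than as unary numbers. *)
Ltac taylor_numbers H :=
  cbn [sum_f_R0] in H; rewrite !fact_simpl, !mult_INR in H; change (fact 0) with 1%nat in H;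
  rewrite !INR_IZR_INZ in H; cbn [Z.of_nat Pos.of_succ_nat Pos.succ pow] in H.

(** The two sides of the bracket for the root of r e^r = PI / 4. *)
Lemma root_lower : 484034.5 / 1000000 * exp (484034.5 / 1000000) < PI / 4.
Proof.
pose proof (exp_le_taylor (484034.5 / 1000000) 9) as H. taylor_numbers H.
pose proof PI_bounds. specialize (H ltac:(lra)). lra.
Qed.

Lemma root_upper : PI / 4 < 484035.5 / 1000000 * exp (484035.5 / 1000000).
Proof.
pose proof (exp_ge_taylor (484035.5 / 1000000) 9) as H. taylor_numbers H.
pose proof PI_bounds. specialize (H ltac:(lra)). lra.
Qed.

Lemma ln_bound : ln (1 + PI / 4) < 0.65.
Proof.
pose proof (exp_ge_taylor 0.65 3) as H. taylor_numbers H.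
pose proof PI_bounds. specialize (H ltac:(lra)).
rewrite <- (ln_exp 0.65). apply ln_increasing; lra.
Qed.

(** * Power series of the five functions psi *)

(** ** The exponential series *)

(** 1/n! *)
Definition exp_coef (n : nat) : C := RtoC (/ INR (fact n)).

Lemma exp_coef_bound (n : nat) : Cmod (exp_coef n) <= 1.
Proof.
unfold exp_coef. rewrite Cmod_R, Rabs_pos_eq.
- rewrite <- Rinv_1. apply Rinv_le_contravar; [lra|].
  apply (le_INR 1). pose proof (lt_O_fact n). lia.
- left. apply Rinv_0_lt_compat, INR_fact_lt_0.
Qed.

Lemma exp_coef_growth : poly_growth exp_coef.
Proof. apply growth_bounded with 1, exp_coef_bound. Qed.

Lemma Cexp_CPS (z : C) : unit_disc z -> Cexp z = CPS exp_coef z.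
Proof.
intros Hz. symmetry.
apply (linear_ode_unique (fun _ => RtoC 1)); [| | | |exact Hz].
- intros x Hx. rewrite Cmult_1_l.
  rewrite <- (CPS_ext (PSd exp_coef) exp_coef x); [apply CPS_deriv; [apply exp_coef_growth|exact Hx]
    |apply growth_PSd, exp_coef_growth|apply exp_coef_growth|exact Hx|].
  intros n. unfold PSd, exp_coef. rewrite <- RtoC_mult. f_equal.
  rewrite fact_simpl, mult_INR. field. split; [apply INR_fact_neq_0|apply not_0_INR; lia].
- intros x _. rewrite Cmult_1_l. apply Cderiv_Cexp.
- intros x _. apply Cexp_neq_0.
- rewrite CPS_0 by apply exp_coef_growth. rewrite Cexp_0. unfold exp_coef. simpl. now rewrite Rinv_1.
Qed.

(** ** The binomial series of sqrt (1 + z) *)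

(** The binomial coefficients of exponent 1/2. *)
Fixpoint sqrt_coef_R (n : nat) : R :=
  match n with
  | O => 1
  | S m => (/ 2 - INR m) / INR (S m) * sqrt_coef_R m
  end.

Definition sqrt_coef (n : nat) : C := RtoC (sqrt_coef_R n).

Lemma Rabs_mult_le_1 (x y : R) : Rabs x <= 1 -> Rabs y <= 1 -> Rabs (x * y) <= 1.
Proof.
intros Hx Hy. rewrite Rabs_mult, <- (Rmult_1_r 1).
apply Rmult_le_compat; try apply Rabs_pos; assumption.
Qed.

Lemma Rabs_div_le_1 (x y : R) : 0 < y -> - y <= x <= y -> Rabs (x / y) <= 1.
Proof.
intros Hy Hx. rewrite Rabs_div, (Rabs_pos_eq y) by lra.
apply Rle_div_l; [exact Hy|]. rewrite Rmult_1_l. apply Rabs_le. exact Hx.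
Qed.

Lemma sqrt_coef_bound (n : nat) : Cmod (sqrt_coef n) <= 1.
Proof.
unfold sqrt_coef. rewrite Cmod_R. induction n as [|n IH].
- simpl. rewrite Rabs_R1. lra.
- cbn [sqrt_coef_R]. apply Rabs_mult_le_1; [|exact IH].
  rewrite S_INR. pose proof (pos_INR n). apply Rabs_div_le_1; lra.
Qed.

Lemma sqrt_coef_growth : poly_growth sqrt_coef.
Proof. apply growth_bounded with 1, sqrt_coef_bound. Qed.

Lemma Re_1_plus (z : C) : unit_disc z -> 0 < Re (1 + z)%C.
Proof.
unfold unit_disc. intros Hz. pose proof (re_le_Cmod z) as B. apply Rabs_le_between in B.
unfold Re, Cplus in *; simpl in *. lra.
Qed.

Lemma Csqrt_neq_0 (z : C) : 0 < Re z -> Csqrt z <> 0.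
Proof. intros H. apply Re_pos_neq_0, Re_Csqrt_pos, H. Qed.

(** Both sides solve 2 (1 + z) y' = y with y(0) = 1. *)
Lemma Csqrt_CPS (z : C) : unit_disc z -> Csqrt (1 + z)%C = CPS sqrt_coef z.
Proof.
intros Hz. symmetry.
pose proof sqrt_coef_growth as G.
apply (linear_ode_unique (fun x => / (2 * (1 + x)))%C _ (fun x => Csqrt (1 + x)%C)); [| | | |exact Hz].
- intros x Hx. set (y := CPS sqrt_coef x). set (y' := CPS (PSd sqrt_coef) x).
  (* the recursion on the coefficients, read as an equation between sums *)
  assert (E : y' = (/ 2 * y - x * y')%C).
  { apply CPS_unique; [apply growth_PSd; exact G|exact Hx|].
    generalize (Cseries_minus _ _ _ _ (Cseries_scal (/ 2)%C _ _ (CPS_correct _ x G Hx))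
      (Cseries_euler _ x G Hx)).
    apply Cseries_ext. intros n. unfold PSd, sqrt_coef. cbn [sqrt_coef_R].
    replace (/ 2 * (sqrt_coef_R n * x ^ n) - INR n * sqrt_coef_R n * x ^ n)%C
      with (RtoC ((/ 2 - INR n) * sqrt_coef_R n) * x ^ n)%C.
    2:{ rewrite RtoC_mult, RtoC_minus, RtoC_inv by lra. ring. }
    rewrite <- RtoC_mult. f_equal. f_equal. field. apply not_0_INR; lia. }
  assert (N : (1 + x)%C <> 0) by (apply Re_pos_neq_0, Re_1_plus, Hx).
  assert (E2 : y' = (/ (2 * (1 + x)) * y)%C).
  { replace y with (2 * (1 + x) * y')%C; [field; exact N|].
    replace (2 * (1 + x) * y')%C with (2 * (y' + x * y'))%C by ring.
    rewrite E at 1. field. }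
  rewrite <- E2. apply CPS_deriv; assumption.
- intros x Hx.
  replace (/ (2 * (1 + x)) * Csqrt (1 + x))%C with (/ (2 * (1 + x)) * Csqrt (1 + x) * (0 + 1))%C by ring.
  apply (Cderiv_comp Csqrt (fun x => 1 + x)%C); [apply Cderiv_Csqrt, Re_1_plus, Hx|].
  apply Cderiv_plus; [apply Cderiv_const|apply Cderiv_id].
- intros x Hx. apply Csqrt_neq_0, Re_1_plus, Hx.
- rewrite CPS_0, Cplus_0_r, Csqrt_1 by exact G. reflexivity.
Qed.

(** ** The series of sqrt (1 + z^2) *)

(** The recursion d_(m+2) = (1 - m)/(m + 2) d_m expresses (1 + z^2) y' = z y. *)
Fixpoint sqrt2_coef_R (n : nat) : R :=
  match n with
  | O => 1
  | S O => 0
  | S (S m) => (1 - INR m) / INR (S (S m)) * sqrt2_coef_R m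
  end.

Definition sqrt2_coef (n : nat) : C := RtoC (sqrt2_coef_R n).

Lemma sqrt2_coef_bound (n : nat) : Cmod (sqrt2_coef n) <= 1.
Proof.
unfold sqrt2_coef. rewrite Cmod_R.
enough (H : Rabs (sqrt2_coef_R n) <= 1 /\ Rabs (sqrt2_coef_R (S n)) <= 1) by apply H.
induction n as [|n [IH1 IH2]].
- simpl. rewrite Rabs_R1, Rabs_R0. lra.
- split; [exact IH2|]. cbn [sqrt2_coef_R]. apply Rabs_mult_le_1; [|exact IH1].
  rewrite !S_INR. pose proof (pos_INR n). apply Rabs_div_le_1; lra.
Qed.

Lemma sqrt2_coef_growth : poly_growth sqrt2_coef.
Proof. apply growth_bounded with 1, sqrt2_coef_bound. Qed.

Lemma unit_disc_sqr (z : C) : unit_disc z -> unit_disc (z ^ 2)%C.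
Proof.
unfold unit_disc. intros H. rewrite Cmod_pow. pose proof (Cmod_ge_0 z). nra.
Qed.

(** Both sides solve (1 + z^2) y' = z y with y(0) = 1. *)
Lemma Csqrt2_CPS (z : C) : unit_disc z -> Csqrt (1 + z ^ 2)%C = CPS sqrt2_coef z.
Proof.
intros Hz. symmetry.
pose proof sqrt2_coef_growth as G.
assert (P : forall x, unit_disc x -> 0 < Re (1 + x ^ 2)%C).
{ intros x Hx. apply Re_1_plus, unit_disc_sqr, Hx. }
apply (linear_ode_unique (fun x => x / (1 + x ^ 2))%C _ (fun x => Csqrt (1 + x ^ 2)%C)); [| | | |exact Hz].
- intros x Hx. set (y := CPS sqrt2_coef x). set (y' := CPS (PSd sqrt2_coef) x).
  assert (Gd : poly_growth (PSd sqrt2_coef)) by (apply growth_PSd; exact G).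
  assert (E : y' = (x * (y - x * y'))%C).
  { unfold y' at 1. rewrite CPS_tail by assumption.
    replace (PSd sqrt2_coef 0) with (RtoC 0) by (unfold PSd, sqrt2_coef; simpl; ring).
    rewrite Cplus_0_l. f_equal.
    apply CPS_unique; [apply growth_tail; exact Gd|exact Hx|].
    generalize (Cseries_minus _ _ _ _ (CPS_correct _ x G Hx) (Cseries_euler _ x G Hx)).
    apply Cseries_ext. intros n. unfold PSd, sqrt2_coef. cbn [sqrt2_coef_R].
    replace (sqrt2_coef_R n * x ^ n - INR n * sqrt2_coef_R n * x ^ n)%C
      with (RtoC ((1 - INR n) * sqrt2_coef_R n) * x ^ n)%C.
    2:{ rewrite RtoC_mult, RtoC_minus. ring. }
    rewrite <- RtoC_mult. f_equal. f_equal. field. apply not_0_INR; lia. }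
  assert (N : (1 + x ^ 2)%C <> 0) by (apply Re_pos_neq_0, P, Hx).
  assert (E2 : y' = (x / (1 + x ^ 2) * y)%C).
  { replace (x / (1 + x ^ 2) * y)%C with ((x * (y - x * y') + x ^ 2 * y') / (1 + x ^ 2))%C
      by (field; exact N).
    rewrite <- E. field. exact N. }
  rewrite <- E2. apply CPS_deriv; assumption.
- intros x Hx.
  replace (x / (1 + x ^ 2) * Csqrt (1 + x ^ 2))%C
    with (/ (2 * (1 + x ^ 2)) * Csqrt (1 + x ^ 2) * (0 + 2 * x))%C
    by (field; apply Re_pos_neq_0, P, Hx).
  apply (Cderiv_comp Csqrt (fun x => 1 + x ^ 2)%C); [apply Cderiv_Csqrt, P, Hx|].
  apply Cderiv_plus; [apply Cderiv_const|].
  apply Cderiv_ext with (fun x => x * x)%C; [intros; ring|apply Cderiv_sqr].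
- intros x Hx. apply Csqrt_neq_0, P, Hx.
- rewrite CPS_0 by exact G. replace (1 + 0 ^ 2)%C with (RtoC 1) by ring. rewrite Csqrt_1. reflexivity.
Qed.

(** * The five radii *)

Lemma Csqrt_square (x : R) : 0 < x -> Csqrt (RtoC (x * x)) = x.
Proof.
intros Hx.
assert (P : 0 < Re (RtoC (x * x))) by (unfold Re; simpl; nra).
pose proof (Csqrt_sqr _ P) as E. pose proof (Re_Csqrt_pos _ P) as S.
set (s := Csqrt (RtoC (x * x))) in *.
assert (N : (s + x)%C <> 0).
{ apply Re_pos_neq_0. unfold Re, Cplus in *; simpl in *. lra. }
assert (Z : ((s - x) * (s + x))%C = 0).
{ replace ((s - x) * (s + x))%C with (s * s - x * x)%C by ring. rewrite E, RtoC_mult. ring. }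
apply Ceq_minus. apply NNPP. intros M. now apply (Cmult_neq_0 _ _ M N) in Z.
Qed.

Lemma Re_sqr_le (s : C) : Re (s * s)%C <= Re s ^ 2 <= Cmod (s * s)%C.
Proof.
split.
- destruct s; unfold Re; simpl. nra.
- rewrite Cmod_mult. pose proof (re_le_Cmod s) as H. rewrite <- (Rabs_pos_eq (Cmod s)) in H by apply Cmod_ge_0.
  apply Rsqr_le_abs_1 in H. unfold Rsqr in H. lra.
Qed.

Lemma Re_plus (a b : C) : Re (a + b)%C = Re a + Re b.
Proof. reflexivity. Qed.

(** psi = sqrt (1 + z) leaves the strip on its left side, at z = -R0, where
    1 - R0 = (1 - PI/4)^2. *)
Lemma radius_L :
  is_radius S_tau S_L (PI * (8 - PI) / 16) /\ sharp S_tau S_L (PI * (8 - PI) / 16).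
Proof.
pose proof PI_bounds as HPI.
set (t := 1 - PI / 4). set (R0 := PI * (8 - PI) / 16).
assert (ER : 1 - R0 = t * t) by (unfold t, R0; field).
assert (Ht : 0.2 < t < 0.25) by (unfold t; lra).
assert (HR : 0 < R0 < 1) by nra.
apply (tau_radius _ sqrt_coef R0 (RtoC (- R0))).
- exact HR.
- intros k. pose proof (sqrt_coef_bound k). lra.
- reflexivity.
- exact Csqrt_CPS.
- intros u Hu. assert (Du : unit_disc u) by (unfold unit_disc; lra).
  pose proof (Re_1_plus u Du) as P.
  pose proof (Re_Csqrt_pos _ P) as S. pose proof (Re_sqr_le (Csqrt (1 + u)%C)) as Q.
  rewrite Csqrt_sqr in Q by exact P.
  assert (M : Cmod (1 + u)%C <= 1 + Cmod u) by (eapply Rle_trans; [apply Cmod_triangle|rewrite Cmod_1; lra]).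
  rewrite Re_plus in Q. change (Re 1) with 1 in Q.
  pose proof (re_le_Cmod u) as B. apply Rabs_le_between in B.
  set (s := Re (Csqrt (1 + u)%C)) in *.
  assert (t < s) by nra. assert (s < 1.5) by nra.
  apply Rabs_def1; unfold t in *; lra.
- rewrite Cmod_R, Rabs_Ropp, Rabs_pos_eq; lra.
- replace (1 + RtoC (- R0))%C with (RtoC (t * t)) by (rewrite <- ER, RtoC_minus, RtoC_opp; ring).
  rewrite Csqrt_square by lra. change (Re (RtoC t)) with t.
  rewrite Rabs_left by lra. unfold t. lra.
Qed.

(** Coefficients of 1 + 4z/3 + 2z^2/3. *)
Definition cardioid_coef (n : nat) : C :=
  match n with
  | O => 1
  | 1%nat => 4 / 3
  | 2%nat => 2 / 3
  | _ => 0
  end%C.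

Lemma cardioid_coef_bound (n : nat) : Cmod (cardioid_coef n) <= 2.
Proof.
assert (N3 : RtoC 3 <> 0) by (apply RtoC_neq_0; lra).
destruct n as [|[|[|n]]]; simpl.
- rewrite Cmod_1. lra.
- rewrite Cmod_div, !Cmod_R, !Rabs_pos_eq by (exact N3 || lra). lra.
- rewrite Cmod_div, !Cmod_R, !Rabs_pos_eq by (exact N3 || lra). lra.
- rewrite Cmod_0. lra.
Qed.

(** Here |psi(u) - 1| <= psi(|u|) - 1, and (R0 + 1)^2 = 1 + 3 PI / 8 is psi(R0) - 1 = PI / 4. *)
Lemma radius_C :
  is_radius S_tau S_C (sqrt (1 + 3 * PI / 8) - 1) /\ sharp S_tau S_C (sqrt (1 + 3 * PI / 8) - 1).
Proof.
pose proof PI_bounds as HPI.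
assert (N3 : RtoC 3 <> 0) by (apply RtoC_neq_0; lra).
set (R0 := sqrt (1 + 3 * PI / 8) - 1).
assert (ER : (R0 + 1) * (R0 + 1) = 1 + 3 * PI / 8).
{ unfold R0. replace (sqrt (1 + 3 * PI / 8) - 1 + 1) with (sqrt (1 + 3 * PI / 8)) by ring.
  apply sqrt_sqrt. lra. }
assert (HR1 : -1 <= R0) by (unfold R0; pose proof (sqrt_pos (1 + 3 * PI / 8)); lra).
assert (HR : 0 < R0 < 1) by nra.
assert (G : poly_growth cardioid_coef) by (apply growth_bounded with 2, cardioid_coef_bound).
apply (tau_radius _ cardioid_coef R0 (RtoC R0)).
- exact HR.
- exact cardioid_coef_bound.
- reflexivity.
- intros z Hz.
  rewrite (CPS_tail _ z G Hz), (CPS_tail _ z (growth_tail _ G) Hz),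
    (CPS_tail _ z (growth_tail _ (growth_tail _ G)) Hz).
  change (fun n => cardioid_coef (S (S (S n)))) with (fun _ : nat => RtoC 0).
  rewrite CPS_zero by exact Hz. simpl cardioid_coef. field.
- intros u Hu.
  replace (Re (1 + 4 * u / 3 + 2 * u ^ 2 / 3)%C - 1) with (Re ((4 / 3)%R * u + (2 / 3)%R * (u * u))%C).
  2:{ replace (1 + 4 * u / 3 + 2 * u ^ 2 / 3)%C with (1 + ((4 / 3)%R * u + (2 / 3)%R * (u * u)))%C.
      - rewrite (Re_plus 1). change (Re 1) with 1. ring.
      - rewrite !RtoC_div by lra. field. }
  eapply Rle_lt_trans; [apply re_le_Cmod|]. eapply Rle_lt_trans; [apply Cmod_triangle|].
  rewrite !Cmod_mult, !Cmod_R, !Rabs_pos_eq by lra.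
  pose proof (Cmod_ge_0 u). nra.
- rewrite Cmod_R, Rabs_pos_eq; lra.
- replace (1 + 4 * R0 / 3 + 2 * R0 ^ 2 / 3)%C with (RtoC (1 + 4 / 3 * R0 + 2 / 3 * (R0 * R0))).
  2:{ rewrite !RtoC_plus, !RtoC_mult, !RtoC_div by lra. field. }
  unfold Re; simpl. rewrite Rabs_pos_eq; nra.
Qed.

Lemma cos_ge_quadratic (y : R) : Rabs y <= 1 -> 1 - y ^ 2 / 2 <= cos y.
Proof.
intros H. apply Rabs_le_between in H.
destruct (pre_cos_bound y 0) as [L _]; [lra|lra|].
unfold cos_approx, cos_term in L. simpl in L. lra.
Qed.

(** The lower bound, (1 - 0.65)(1 - 0.65^2 / 2) > 0.27, exceeds 1 - PI / 4: only the
    upper side of the strip matters for the exponential. *)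
Lemma Re_Cexp_bounds (u : C) : Cmod u < 0.65 ->
  0.27 < Re (Cexp u) <= exp (Cmod u).
Proof.
intros Hu. change (Re (Cexp u)) with (exp (Re u) * cos (Im u)).
pose proof (re_le_Cmod u) as A. pose proof (im_le_Cmod u) as B.
pose proof (cos_ge_quadratic (Im u)) as K. specialize (K ltac:(lra)).
apply Rabs_le_between in A. apply Rabs_le_between in B.
pose proof (exp_ineq1_le (Re u)) as L. pose proof (exp_pos (Re u)) as P.
pose proof (COS_bound (Im u)) as Q.
split.
- assert (Im u ^ 2 < 0.4225) by nra. nra.
- apply Rle_trans with (exp (Re u)); [nra|].
  destruct (Rle_lt_or_eq_dec (Re u) (Cmod u)) as [S|S]; [lra| |].
  + left. apply exp_increasing; exact S.
  + rewrite S. lra.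
Qed.

Lemma radius_e :
  is_radius S_tau S_e (ln (1 + PI / 4)) /\ sharp S_tau S_e (ln (1 + PI / 4)).
Proof.
pose proof PI_bounds as HPI. pose proof ln_bound as HL.
set (R0 := ln (1 + PI / 4)) in *.
assert (E : exp R0 = 1 + PI / 4) by (apply exp_ln; lra).
assert (P : 0 < R0) by (unfold R0; rewrite <- ln_1; apply ln_increasing; lra).
apply (tau_radius _ exp_coef R0 (RtoC R0)).
- lra.
- intros k. pose proof (exp_coef_bound k). lra.
- unfold exp_coef. simpl. now rewrite Rinv_1.
- exact Cexp_CPS.
- intros u Hu. destruct (Re_Cexp_bounds u) as [L U]; [lra|].
  apply exp_increasing in Hu. apply Rabs_def1; lra.
- rewrite Cmod_R, Rabs_pos_eq; lra.
- rewrite Cexp_real, E. change (Re (RtoC (1 + PI / 4))) with (1 + PI / 4).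
  rewrite Rabs_pos_eq; lra.
Qed.

(** Coefficients of z + sqrt (1 + z^2). *)
Definition delta_coef (n : nat) : C := match n with 1%nat => RtoC 1 | _ => sqrt2_coef n end.

Lemma delta_coef_bound (n : nat) : Cmod (delta_coef n) <= 1.
Proof.
destruct n as [|[|n]]; [apply sqrt2_coef_bound| |apply sqrt2_coef_bound].
simpl. rewrite Cmod_1. lra.
Qed.

(** The strip is left on its right side, at z = R0.  For the left side,
    (Re sqrt (1 + u^2))^2 >= Re (1 + u^2) = 1 - |u|^2 + 2 (Re u)^2 shows that
    Re psi stays away from 1 - PI/4. *)
Lemma radius_Delta :
  is_radius S_tau Delta_star (PI * (8 + PI) / (8 * (4 + PI))) /\
  sharp S_tau Delta_star (PI * (8 + PI) / (8 * (4 + PI))).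
Proof.
pose proof PI_bounds as HPI.
set (t := 1 + PI / 4). set (R0 := PI * (8 + PI) / (8 * (4 + PI))).
assert (Ht : 1.785 < t < 1.7855) by (unfold t; lra).
(* [R0] is defined by R0 + sqrt (1 + R0^2) = t, the abscissa of the right side of the strip *)
assert (ER : 2 * t * R0 = t * t - 1) by (unfold t, R0; field; lra).
assert (HR : 0.6 < R0 < 0.613) by (split; apply Rnot_le_lt; intros L; nra).
assert (ES : 1 + R0 * R0 = (t - R0) * (t - R0)) by nra.
assert (G : poly_growth delta_coef) by (apply growth_bounded with 1, delta_coef_bound).
pose proof sqrt2_coef_growth as G2.
apply (tau_radius _ delta_coef R0 (RtoC R0)).
- lra.
- intros k. pose proof (delta_coef_bound k). lra.
- reflexivity.
- intros z Hz. rewrite Csqrt2_CPS by exact Hz.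
  rewrite (CPS_tail _ z G Hz), (CPS_tail _ z (growth_tail _ G) Hz),
    (CPS_tail _ z G2 Hz), (CPS_tail _ z (growth_tail _ G2) Hz).
  change (fun n => delta_coef (S (S n))) with (fun n => sqrt2_coef (S (S n))).
  simpl delta_coef. unfold sqrt2_coef at 1 2 4. simpl. ring.
- intros u Hu. assert (Du : unit_disc u) by (unfold unit_disc; lra).
  pose proof (Re_1_plus _ (unit_disc_sqr _ Du)) as P.
  pose proof (Re_Csqrt_pos _ P) as S. pose proof (Re_sqr_le (Csqrt (1 + u ^ 2)%C)) as Q.
  rewrite Csqrt_sqr in Q by exact P.
  assert (M : Cmod (1 + u ^ 2)%C <= 1 + Cmod u ^ 2).
  { eapply Rle_trans; [apply Cmod_triangle|rewrite Cmod_1, Cmod_pow; lra]. }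
  pose proof (Cmod2_alt u) as N.
  assert (Eq : Re (1 + u ^ 2)%C = 1 + Re u ^ 2 - Im u ^ 2).
  { destruct u; unfold Re, Im; simpl. ring. }
  rewrite Re_plus.
  set (s := Re (Csqrt (1 + u ^ 2)%C)) in *.
  pose proof (re_le_Cmod u) as B. apply Rabs_le_between in B.
  pose proof (Cmod_ge_0 u) as N0.
  set (r := Cmod u) in *. set (x := Re u) in *.
  assert (r ^ 2 < R0 * R0) by nra.
  assert (U : s < t - R0).
  { apply Rnot_le_lt. intros C0.
    assert ((t - R0) * (t - R0) <= s * s) by (apply Rmult_le_compat; lra). lra. }
  assert (R2 : R0 * R0 < 0.376) by nra.
  assert (L0 : 0.624 + 2 * x ^ 2 < s ^ 2) by lra.
  assert (L : 0.22 - x < s).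
  { apply Rnot_le_lt. intros C0. assert (s ^ 2 <= (0.22 - x) ^ 2) by (apply pow_incr; lra).
    pose proof (pow2_ge_0 (x + 0.22)). lra. }
  apply Rabs_def1; unfold t in *; lra.
- rewrite Cmod_R, Rabs_pos_eq; lra.
- replace (1 + R0 ^ 2)%C with (RtoC ((t - R0) * (t - R0))).
  2:{ rewrite <- ES, RtoC_plus, RtoC_mult. ring. }
  rewrite Csqrt_square by lra. rewrite <- RtoC_plus.
  change (Re (RtoC (R0 + (t - R0)))) with (R0 + (t - R0)).
  rewrite Rabs_pos_eq; unfold t; lra.
Qed.

(** Coefficients of 1 + z e^z. *)
Definition wp_coef (n : nat) : C := match n with O => RtoC 1 | S m => exp_coef m end.

Lemma wp_coef_bound (n : nat) : Cmod (wp_coef n) <= 1.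
Proof. destruct n as [|n]; [simpl; rewrite Cmod_1; lra|apply exp_coef_bound]. Qed.

Lemma x_exp_increasing (x y : R) : 0 <= x < y -> x * exp x < y * exp y.
Proof.
intros H. pose proof (exp_increasing x y ltac:(lra)) as E. pose proof (exp_pos x). nra.
Qed.

Lemma x_exp_root : exists r0, 484034.5 / 1000000 < r0 < 484035.5 / 1000000 /\ r0 * exp r0 = PI / 4.
Proof.
set (F := fun x => x * exp x - PI / 4).
destruct (IVT F (484034.5 / 1000000) (484035.5 / 1000000)) as [r [Hr Er]].
- intros x. apply derivable_continuous_pt. unfold F. reg.
- lra.
- unfold F. pose proof root_lower. lra.
- unfold F. pose proof root_upper. lra.
- exists r. unfold F in Er. split; [|lra].
  pose proof root_lower. pose proof root_upper.
  assert (r <> 484034.5 / 1000000) by (intros E; rewrite E in Er; lra).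
  assert (r <> 484035.5 / 1000000) by (intros E; rewrite E in Er; lra).
  lra.
Qed.

(** Here |u e^u| <= |u| e^|u|, with equality for positive u. *)
Lemma radius_wp (r0 : R) : 0 < r0 < 1 -> r0 * exp r0 = PI / 4 ->
  is_radius S_tau S_wp r0 /\ sharp S_tau S_wp r0.
Proof.
intros Hr E. pose proof PI_bounds as HPI.
assert (G : poly_growth wp_coef) by (apply growth_bounded with 1, wp_coef_bound).
apply (tau_radius _ wp_coef r0 (RtoC r0)).
- exact Hr.
- intros k. pose proof (wp_coef_bound k). lra.
- reflexivity.
- intros z Hz. rewrite (CPS_tail _ z G Hz), Cexp_CPS by exact Hz. reflexivity.
- intros u Hu. rewrite Re_plus. change (Re 1) with 1.
  replace (1 + Re (u * Cexp u)%C - 1) with (Re (u * Cexp u)%C) by ring.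
  eapply Rle_lt_trans; [apply re_le_Cmod|]. rewrite Cmod_mult, Cmod_Cexp.
  apply Rle_lt_trans with (Cmod u * exp (Cmod u)).
  + apply Rmult_le_compat_l; [apply Cmod_ge_0|].
    pose proof (re_le_Cmod u) as B. apply Rabs_le_between in B.
    destruct (Rle_lt_or_eq_dec (Re u) (Cmod u)) as [S|S]; [lra| |].
    * left. apply exp_increasing; exact S.
    * rewrite S. lra.
  + rewrite <- E. apply x_exp_increasing. split; [apply Cmod_ge_0|exact Hu].
- rewrite Cmod_R, Rabs_pos_eq; lra.
- rewrite Cexp_real, <- RtoC_mult, <- RtoC_plus, E.
  change (Re (RtoC (1 + PI / 4))) with (1 + PI / 4). rewrite Rabs_pos_eq; lra.
Qed.

Theorem theorem3p3 :
  (is_radius S_tau S_L (PI * (8 - PI) / 16) /\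
   sharp S_tau S_L (PI * (8 - PI) / 16)) /\
  (is_radius S_tau S_C (sqrt (1 + 3 * PI / 8) - 1) /\
   sharp S_tau S_C (sqrt (1 + 3 * PI / 8) - 1)) /\
  (is_radius S_tau S_e (ln (1 + PI / 4)) /\
   sharp S_tau S_e (ln (1 + PI / 4))) /\
  (is_radius S_tau Delta_star (PI * (8 + PI) / (8 * (4 + PI))) /\
   sharp S_tau Delta_star (PI * (8 + PI) / (8 * (4 + PI)))) /\
  (exists r0 : R,
     unique (fun r : R => 0 < r /\ r * exp r = PI / 4) r0 /\
     Rabs (r0 - 484035 / 1000000) <= 5 / 10000000 /\
     is_radius S_tau S_wp r0 /\
     sharp S_tau S_wp r0).
Proof.
split; [exact radius_L|]. split; [exact radius_C|]. split; [exact radius_e|].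
split; [exact radius_Delta|].
destruct x_exp_root as [r0 [Hr0 E0]]. exists r0. split; [|split].
- split; [split; [lra|exact E0]|]. intros r [Hr E].
  destruct (Rtotal_order r0 r) as [L|[L|L]]; [|exact L|].
  + pose proof (x_exp_increasing r0 r ltac:(lra)). lra.
  + pose proof (x_exp_increasing r r0 ltac:(lra)). lra.
- apply Rabs_le. lra.
- apply radius_wp; [lra|exact E0].
Qed.
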